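(* Let $u,v,w\in W$ with $u\le v\le w$ in the Bruhat order, with fixed reduced expressions $\underline u,\underline v,\underline w$. Let $$\Phi^{u,v}_{\underline w}:\operatorname{Hom}^{\mathbb{Z}}(BS(\underline w),R_v)\otimes_R\mathbb{R}\to\operatorname{Hom}^{\mathbb{Z}}(BS(\underline w),R_u)\otimes_R\mathbb{R}$$ be the $\mathbb{R}$-linear map determined on the basis $\{(\beta_v\circ l)\otimes1: l\in\mathbb{L}_{\underline w}(v)\}$ by $(\beta_v\circ l)\otimes1\mapsto(\beta_u\circ G^u_v\circ l)\otimes1$. Then $\Phi^{u,v}_{\underline w}$ is injective.
   Context: **Bott-Samelson and standard bimodules.** $(W,S)$ is a Coxeter system with length $l$, Bruhat order $\le$, $m_{st}$ the order of $st$. An expression is a finite sequence $\underline{w}=s_1\ldots s_n$ of elements of $S$; $w\in W$ denotes its product; it is reduced if $l(w)=n$. Fix a reflection-faithful representation $V$ of $W$ over $\mathbb{R}$ (finite-dimensional, faithful, and an element has fixed space of codimension one iff it is conjugate to an element of $S$). $R$ is the algebra of regular functions on $V$, graded with $R_2=V^*$, with its $W$-action; $R^+$ is the ideal generated by elements of positive degree, and $\mathbb{R}\cong R/R^+$. For $s\in S$, $R^s$ is the ring of $s$-invariants, $x_s\in V^*$ is an equation of the hyperplane fixed by $s$, and $\partial_s(f)=(f-s\cdot f)/(2x_s)$. For a graded bimodule $B$, $B(k)_i=B_{k+i}$. Put $B_s=R\otimes_{R^s}R(1)$ and $BS(\underline w)=B_{s_1}\otimes_R\cdots\otimes_R B_{s_n}$,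 $BS(\emptyset)=R$; thus $BS(\underline w)\cong R\otimes_{R^{s_1}}R\otimes\cdots\otimes_{R^{s_n}}R(n)$. For graded $(R,R)$-bimodules, $\operatorname{Hom}^{\mathbb{Z}}(B,B')$ is the direct sum over $k\in\mathbb{Z}$ of the spaces of bimodule homomorphisms homogeneous of degree $k$ (i.e. $f(B_i)\subset B'_{i+k}$ for all $i$); it is a right $R$-module. For $x\in W$ the standard bimodule $R_x$ is $R$ as a left module, with right action $r\cdot r'=r\,x(r')$, graded so that $1\in R_x$ has degree $-l(x)$. For a reduced expression $\underline x=s_1\ldots s_k$ of $x$, $\beta_x:BS(\underline x)\to R_x$ is the bimodule morphism $p_0\otimes p_1\otimes\cdots\otimes p_k\mapsto p_0\,s_1(p_1)\,(s_1s_2)(p_2)\cdots(s_1\cdots s_k)(p_k)$. **Leaves.** Basic morphisms: $m_s:BS(s)\to R$, $p\otimes q\mapsto pq$ (degree 1); $j_s:BS(ss)\to BS(s)$, $1\otimes p\otimes1\mapsto\partial_s(p)\otimes1$ (degree $-1$); for $m_{sr}<\infty$, $f_{sr}:BS(srs\cdots)\to BS(rsr\cdots)$ ($m_{sr}$ letters each), the unique degree 0 morphism sending $1\otimes\cdots\otimes1$ to $1\otimes\cdots\otimes1$. For an expression $\underline w=s_1\ldots s_n$ a binary tree $\mathbb{T}_{\underline w}$ is built, with nodes Bott-Samelson bimodules and edges morphisms. The root is $BS(\underline w)$. A node of depth $k-1$ ($1\le k\le n$) is $BS(t_1\ldots t_i)BS(s_k\ldots s_n)$ with $t_1\ldots t_i$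 reduced (empty for $k=1$). (a) If $l(t_1\cdots t_is_k)>l(t_1\cdots t_i)$, its two children are $BS(t_1\ldots t_i)BS(s_{k+1}\ldots s_n)$ via $\mathrm{id}\otimes m_{s_k}\otimes\mathrm{id}$, and $BS(t_1\ldots t_is_k)BS(s_{k+1}\ldots s_n)$ via the identity. (b) If $l(t_1\cdots t_is_k)<l(t_1\cdots t_i)$, fix a sequence of braid moves from $t_1\ldots t_i$ to a reduced expression $t_1'\ldots t_{i-1}'s_k$, apply the corresponding composition of morphisms $f_{sr}$ (tensored with identity), then $\mathrm{id}\otimes j_{s_k}\otimes\mathrm{id}$, arriving at $BS(t_1'\ldots t_{i-1}'s_k)BS(s_{k+1}\ldots s_n)$; the two children are obtained by then applying $\mathrm{id}\otimes m_{s_k}\otimes\mathrm{id}$ (giving $BS(t_1'\ldots t_{i-1}')BS(s_{k+1}\ldots s_n)$) or the identity. After $n$ steps each endpoint is $BS(\underline{u}')$ with $\underline u'$ reduced. Fix once and for all a reduced expression $\underline u$ for every $u\in W$, and for each reduced expression $\underline u'$ of $u$ a sequence of braid moves to $\underline u$; compose each endpoint with the corresponding composition of morphisms $f_{sr}$, $BS(\underline u')\to BS(\underline u)$. The resulting composite morphism $BS(\underline w)\to BS(\underline u)$ along a root-to-endpoint path is called a leaf; $\mathbb{L}_{\underline w}(u)\subset\operatorname{Hom}^{\mathbb{Z}}(BS(\underline w),BS(\underline u))$ is the set of leaves ending at $BS(\underline u)$. All choices are fixed; the expressions $\underline u,\underline v,\underline w$ in the claim are the chosen ones, and the unique leaf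 in $\mathbb{L}_{\underline w}(w)$ is taken to be the identity (similarly for $\underline u,\underline v$). **Known facts used to make sense of the claim.** The set $\{\beta_x\circ l: l\in\mathbb{L}_{\underline w}(x)\}$ is a right $R$-basis of $\operatorname{Hom}^{\mathbb{Z}}(BS(\underline w),R_x)$. For $u\le v$ there is a unique leaf in $\mathbb{L}_{\underline v}(u)$ of degree $l(v)-l(u)$; it is denoted $G^u_v:BS(\underline v)\to BS(\underline u)$. *)

(* Defs.v *)
From HB Require Import structures.
From mathcomp Require Import all_boot all_order all_algebra.
From mathcomp Require Import boolp functions reals.
From mathcomp.multinomials Require Import mpoly.

Set Implicit Arguments.
Unset Strict Implicit.
Unset Printing Implicit Defensive.

Import Order.TTheory GRing.Theory Num.Theory.
Local Open Scope ring_scope.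
Local Open Scope quotient_scope.

Section GradedBimodules.
Variables (K : fieldType) (n : nat).
Local Notation R := {mpoly K[n]}.

(* Linear forms have degree 2. *)
Definition rdeg (i : int) (p : R) : Prop :=
  p = 0 \/ exists2 d : nat, i = (d.*2)%:Z & p \is d.-homog.

Lemma rdegB i p q : rdeg i p -> rdeg i q -> rdeg i (p - q).
Proof.
case=> [->|[d -> Hp]]; case=> [->|[e Hde Hq]]; rewrite ?sub0r ?subr0.
- by left; rewrite oppr0.
- by right; exists e => //; rewrite rpredN.
- by right; exists d.
- case: Hde => /double_inj Hde; right; exists d => //.
  by apply: rpredB => //; rewrite Hde.
Qed.

Lemma rdegM i j p q : rdeg i p -> rdeg j q -> rdeg (i + j) (p * q).
Proof.
case=> [->|[d -> Hp]]; first by left; rewrite mul0r.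
case=> [->|[e -> Hq]]; first by left; rewrite mulr0.
by right; exists (d + e)%N; [rewrite doubleD PoszD | apply: dhomogM].
Qed.

Record bimod := Bimod {
  bcar :> zmodType;
  lact : R -> bcar -> bcar;
  ract : bcar -> R -> bcar;
  (* bdeg i is the homogeneous component of degree i; that the components are
     in direct sum is never used and not part of the structure *)
  bdeg : int -> bcar -> Prop;
  lactDr : forall p x y, lact p (x + y) = lact p x + lact p y;
  lactDl : forall p q x, lact (p + q) x = lact p x + lact q x;
  lactA : forall p q x, lact p (lact q x) = lact (p * q) x;
  lact1 : forall x, lact 1 x = x;
  ractDl : forall x y p, ract (x + y) p = ract x p + ract y p;
  ractDr : forall x p q, ract x (p + q) = ract x p + ract x q;
  ractA : forall x p q, ract (ract x p) q = ract x (p * q);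
  ract1 : forall x, ract x 1 = x;
  lractA : forall p x q, ract (lact p x) q = lact p (ract x q);
  bdeg0 : forall i, bdeg i 0;
  bdegB : forall i x y, bdeg i x -> bdeg i y -> bdeg i (x - y);
  bdeg_lact : forall i j p x, rdeg i p -> bdeg j x -> bdeg (i + j) (lact p x);
  bdeg_ract : forall i j x p, bdeg i x -> rdeg j p -> bdeg (i + j) (ract x p)
}.

Section BimodTheory.
Variable B : bimod.
Implicit Types (x y : B) (p q : R).

Lemma lactr0 p : lact p (0 : B) = 0.
Proof. by apply: (@addrI _ (lact p 0)); rewrite -lactDr !addr0. Qed.

Lemma ractl0 p : ract (0 : B) p = 0.
Proof. by apply: (@addrI _ (ract 0 p)); rewrite -ractDl !addr0. Qed.

Lemma lactl0 x : lact 0 x = 0.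
Proof. by apply: (@addrI _ (lact 0 x)); rewrite -lactDl !addr0. Qed.

Lemma ractr0 x : ract x 0 = 0.
Proof. by apply: (@addrI _ (ract x 0)); rewrite -ractDr !addr0. Qed.

Lemma lactrN p x : lact p (- x) = - lact p x.
Proof. by apply: (@addrI _ (lact p x)); rewrite -lactDr !subrr lactr0. Qed.

Lemma ractlN x p : ract (- x) p = - ract x p.
Proof. by apply: (@addrI _ (ract x p)); rewrite -ractDl !subrr ractl0. Qed.

Lemma bdegN i x : bdeg i x -> bdeg i (- x).
Proof. by move=> Hx; rewrite -sub0r; apply: bdegB => //; apply: bdeg0. Qed.

Lemma bdegD i x y : bdeg i x -> bdeg i y -> bdeg i (x + y).
Proof. by move=> Hx Hy; rewrite -[y]opprK; apply/bdegB/bdegN. Qed.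

End BimodTheory.

(* B(k)_i = B_(k + i) *)
Section Shift.
Variables (k : int) (B : bimod).
Let sdeg i (x : B) := bdeg (k + i) x.

Lemma sdeg_lact i j p (x : B) : rdeg i p -> sdeg j x -> sdeg (i + j) (lact p x).
Proof. by rewrite /sdeg addrCA => Hp Hx; apply: bdeg_lact. Qed.

Lemma sdeg_ract i j (x : B) p : sdeg i x -> rdeg j p -> sdeg (i + j) (ract x p).
Proof. by rewrite /sdeg addrA => Hx Hp; apply: bdeg_ract. Qed.

Definition bshift : bimod :=
  @Bimod B (@lact B) (@ract B) sdeg (@lactDr B) (@lactDl B) (@lactA B)
    (@lact1 B) (@ractDl B) (@ractDr B) (@ractA B) (@ract1 B) (@lractA B)
    (fun i => bdeg0 B (k + i)) (fun i => @bdegB B (k + i))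
    sdeg_lact sdeg_ract.
End Shift.

Section Homs.
Variables B B' : bimod.

Definition bimor (f : B -> B') : Prop :=
  [/\ forall x y, f (x + y) = f x + f y,
      forall p x, f (lact p x) = lact p (f x)
    & forall x p, f (ract x p) = ract (f x) p].

Definition homdeg (k : int) (f : B -> B') : Prop :=
  bimor f /\ forall i x, bdeg i x -> bdeg (i + k) (f x).

(* The elements of Hom^Z: finite sums of homogeneous morphisms. *)
Inductive homZ : (B -> B') -> Prop :=
| homZ0 : homZ 0
| homZD k f g of homdeg k f & homZ g : homZ (f + g).

Lemma bimor_add f x y : bimor f -> f (x + y) = f x + f y.
Proof. by case. Qed.

Lemma bimor_0 f : bimor f -> f 0 = 0.
Proof. by case=> fD _ _; apply: (@addrI _ (f 0)); rewrite -fD !addr0. Qed.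

Lemma bimor_opp f x : bimor f -> f (- x) = - f x.
Proof.
move=> Hf; apply: (@addrI _ (f x)).
by rewrite -(bimor_add _ _ Hf) !subrr (bimor_0 Hf).
Qed.

Lemma bimor0 : bimor 0.
Proof.
split=> *; rewrite /= ?addrfctE.
- by rewrite addr0.
- by rewrite [RHS]lactr0.
- by rewrite [RHS]ractl0.
Qed.

Lemma bimorD f g : bimor f -> bimor g -> bimor (f + g).
Proof.
move=> [fD fl fr] [gD gl gr]; split=> *; rewrite !addrfctE.
- by rewrite fD gD addrACA.
- by rewrite fl gl lactDr.
- by rewrite fr gr ractDl.
Qed.

Lemma bimorN f : bimor f -> bimor (- f).
Proof.
move=> [fD fl fr]; split=> *; rewrite !opprfctE.
- by rewrite fD opprD.
- by rewrite fl lactrN.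
- by rewrite fr ractlN.
Qed.

Lemma homdeg0 k : homdeg k 0.
Proof. by split; [exact: bimor0 | move=> *; apply: bdeg0]. Qed.

Lemma homdegD k f g : homdeg k f -> homdeg k g -> homdeg k (f + g).
Proof.
by move=> [Hf df] [Hg dg]; split=> [|i x Hx];
  [apply: bimorD | apply: bdegD; [apply: df | apply: dg]].
Qed.

Lemma homdegN k f : homdeg k f -> homdeg k (- f).
Proof.
by move=> [Hf df]; split=> [|i x Hx]; [apply: bimorN | apply/bdegN/df].
Qed.

Lemma homdegB k f g : homdeg k f -> homdeg k g -> homdeg k (f - g).
Proof. by move=> Hf Hg; apply/homdegD/homdegN. Qed.

Lemma homdeg_homZ k f : homdeg k f -> homZ f.
Proof. by move=> Hf; rewrite -[f]addr0; apply: homZD Hf homZ0. Qed.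

Lemma homZ_bimor f : homZ f -> bimor f.
Proof.
by elim=> [|k {}f g [Hf _] _ Hg]; [apply: bimor0 | apply: bimorD].
Qed.

Lemma homZ_add f g : homZ f -> homZ g -> homZ (f + g).
Proof.
move=> Hf Hg; elim: Hf => [|k f1 f2 Hf1 _ IH]; first by rewrite add0r.
by rewrite -addrA; apply: homZD Hf1 IH.
Qed.

Lemma homZ_opp f : homZ f -> homZ (- f).
Proof.
elim=> [|k f1 f2 Hf1 _ IH]; first by rewrite oppr0; apply: homZ0.
by rewrite opprD; apply: homZD (homdegN Hf1) IH.
Qed.

Definition homZb : {pred B -> B'} := fun f => `[< homZ f >].

Lemma homZb_zmod : zmod_closed homZb.
Proof.
split; first by apply/asboolP; apply: homZ0.
by move=> f g /asboolP Hf /asboolP Hg; apply/asboolP/homZ_add/homZ_opp.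
Qed.

HB.instance Definition _ := GRing.isZmodClosed.Build (B -> B') homZb homZb_zmod.

Record ghom := GHom { gfun :> B -> B'; gfunP : gfun \in homZb }.

HB.instance Definition _ := [isSub for gfun].
HB.instance Definition _ := [Choice of ghom by <:].
HB.instance Definition _ := [SubChoice_isSubZmodule of ghom by <:].

Lemma ghomZ (f : ghom) : homZ f.
Proof. by apply/asboolP; exact: gfunP f. Qed.

Definition mkghom f (Hf : homZ f) : ghom := @GHom f (asboolT Hf).

Lemma ghom_eq (f g : ghom) : (forall x, f x = g x) -> f = g.
Proof. by move=> E; apply/val_inj/funext. Qed.

End Homs.

Lemma mpoly_hom_ind (P : R -> Prop) :
  P 0 -> (forall p q, P p -> P q -> P (p + q)) ->
  (forall i p, rdeg i p -> P p) -> forall p, P p.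
Proof.
move=> P0 PD Ph p; rewrite [p]mpolyE.
elim: (msupp p : seq _) => [|m s IH]; first by rewrite big_nil.
rewrite big_cons; apply: PD IH; apply: (Ph (mdeg m).*2%:Z).
by right; exists (mdeg m) => //; apply: dhomogZ; rewrite dhomogX.
Qed.

(* Hom^Z(B, B') is itself a graded (R, R)-bimodule. *)
Section HomBimod.
Variables B B' : bimod.
Implicit Types f : ghom B B'.

Lemma homZ_lact p (f : B -> B') : homZ f -> homZ (fun x => lact p (f x)).
Proof.
move=> Hf; elim/mpoly_hom_ind: p => [|p q Hp Hq|i p Hp].
- rewrite (_ : (fun _ => _) = 0); first exact: homZ0.
  by apply/funext=> x; rewrite lactl0.
- rewrite (_ : (fun _ => _) = (fun x => lact p (f x)) + (fun x => lact q (f x))).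
    exact: homZ_add.
  by apply/funext=> x; rewrite lactDl.
elim: Hf => [|k {}f g [[fD fl fr] df] _ IH].
- rewrite (_ : (fun _ => _) = 0); first exact: homZ0.
  by apply/funext=> x; rewrite lactr0.
rewrite (_ : (fun _ => _) = (fun x => lact p (f x)) + (fun x => lact p (g x))).
  apply: (@homZD _ _ (i + k)) IH; split; [split=> [x y|q x|x q]|move=> j x Hx].
  - by rewrite fD lactDr.
  - by rewrite fl !lactA mulrC.
  - by rewrite fr lractA.
  - by rewrite addrCA; apply: bdeg_lact Hp (df _ _ Hx).
by apply/funext=> x; rewrite addrfctE lactDr.
Qed.

Lemma homZ_ract p (f : B -> B') : homZ f -> homZ (fun x => ract (f x) p).
Proof.
move=> Hf; elim/mpoly_hom_ind: p => [|p q Hp Hq|i p Hp].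
- rewrite (_ : (fun _ => _) = 0); first exact: homZ0.
  by apply/funext=> x; rewrite ractr0.
- rewrite (_ : (fun _ => _) = (fun x => ract (f x) p) + (fun x => ract (f x) q)).
    exact: homZ_add.
  by apply/funext=> x; rewrite ractDr.
elim: Hf => [|k {}f g [[fD fl fr] df] _ IH].
- rewrite (_ : (fun _ => _) = 0); first exact: homZ0.
  by apply/funext=> x; rewrite ractl0.
rewrite (_ : (fun _ => _) = (fun x => ract (f x) p) + (fun x => ract (g x) p)).
  apply: (@homZD _ _ (k + i)) IH; split; [split=> [x y|q x|x q]|move=> j x Hx].
  - by rewrite fD ractDl.
  - by rewrite fl lractA.
  - by rewrite fr !ractA mulrC.
  - by rewrite addrA; apply: bdeg_ract (df _ _ Hx) Hp.
by apply/funext=> x; rewrite addrfctE ractDl.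
Qed.

Definition hlact p f : ghom B B' := mkghom (homZ_lact p (ghomZ f)).
Definition hract f p : ghom B B' := mkghom (homZ_ract p (ghomZ f)).
Definition hdeg k f : Prop := homdeg k f.

Fact hlactDr p f g : hlact p (f + g) = hlact p f + hlact p g.
Proof. by apply: ghom_eq => x; apply: lactDr. Qed.
Fact hlactDl p q f : hlact (p + q) f = hlact p f + hlact q f.
Proof. by apply: ghom_eq => x; apply: lactDl. Qed.
Fact hlactA p q f : hlact p (hlact q f) = hlact (p * q) f.
Proof. by apply: ghom_eq => x; apply: lactA. Qed.
Fact hlact1 f : hlact 1 f = f.
Proof. by apply: ghom_eq => x; apply: lact1. Qed.
Fact hractDl f g p : hract (f + g) p = hract f p + hract g p.
Proof. by apply: ghom_eq => x; apply: ractDl. Qed.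
Fact hractDr f p q : hract f (p + q) = hract f p + hract f q.
Proof. by apply: ghom_eq => x; apply: ractDr. Qed.
Fact hractA f p q : hract (hract f p) q = hract f (p * q).
Proof. by apply: ghom_eq => x; apply: ractA. Qed.
Fact hract1 f : hract f 1 = f.
Proof. by apply: ghom_eq => x; apply: ract1. Qed.
Fact hlractA p f q : hract (hlact p f) q = hlact p (hract f q).
Proof. by apply: ghom_eq => x; apply: lractA. Qed.
Fact hdeg0 k : hdeg k 0.
Proof. exact: homdeg0. Qed.
Fact hdegB k f g : hdeg k f -> hdeg k g -> hdeg k (f - g).
Proof. exact: homdegB. Qed.
Fact hdeg_lact i k p f : rdeg i p -> hdeg k f -> hdeg (i + k) (hlact p f).
Proof.
move=> Hp [[fD fl fr] df]; split; first exact/homZ_bimor/ghomZ.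
by move=> j x Hx; rewrite addrCA; apply: bdeg_lact Hp (df _ _ Hx).
Qed.
Fact hdeg_ract k i f p : hdeg k f -> rdeg i p -> hdeg (k + i) (hract f p).
Proof.
move=> [[fD fl fr] df] Hp; split; first exact/homZ_bimor/ghomZ.
by move=> j x Hx; rewrite addrA; apply: bdeg_ract (df _ _ Hx) Hp.
Qed.

Definition hombimod : bimod :=
  @Bimod (ghom B B') hlact hract hdeg hlactDr hlactDl hlactA hlact1 hractDl
    hractDr hractA hract1 hlractA hdeg0 hdegB hdeg_lact hdeg_ract.
End HomBimod.

Section Composition.
Variables B1 B2 B3 : bimod.

Lemma homdeg_id : homdeg 0 (@id B1).
Proof. by split=> [|i x]; [split | rewrite addr0]. Qed.

Lemma homdeg_comp k l (f : B2 -> B3) (g : B1 -> B2) :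
  homdeg k f -> homdeg l g -> homdeg (l + k) (f \o g).
Proof.
move=> [[fD fl fr] df] [[gD gl gr] dg]; split; first split=> *.
- by rewrite /= gD fD.
- by rewrite /= gl fl.
- by rewrite /= gr fr.
- by move=> i x Hx; rewrite addrA; apply/df/dg.
Qed.

Lemma homZ_comp (f : B2 -> B3) (g : B1 -> B2) :
  homZ f -> homZ g -> homZ (f \o g).
Proof.
move=> Hf Hg; elim: Hf => [|k {}f f' Hf _ IH].
  by rewrite (_ : 0 \o g = 0); [exact: homZ0 | apply/funext].
rewrite (_ : (f + f') \o g = (f \o g) + (f' \o g)); last exact/funext.
apply: homZ_add IH; elim: Hg => [|l {}g g' Hg _ IH].
  rewrite (_ : f \o 0 = 0); first exact: homZ0.
  by apply/funext=> x; apply: bimor_0; case: Hf.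
rewrite (_ : f \o (g + g') = (f \o g) + (f \o g')).
  by apply: homZD (homdeg_comp Hf Hg) IH.
by apply/funext=> x; apply: bimor_add; case: Hf.
Qed.

Definition gid : ghom B1 B1 := mkghom (homdeg_homZ homdeg_id).
Definition gcomp (f : ghom B2 B3) (g : ghom B1 B2) : ghom B1 B3 :=
  mkghom (homZ_comp (ghomZ f) (ghomZ g)).
End Composition.

(* The tensor product M (x)_A N over a subring A of R (given by its membership
   predicate), as formal sums of pairs modulo the defining relations. *)
Section Tensor.
Variables (A : R -> Prop) (M N : bimod).

Inductive tensor_rel : seq (M * N) -> seq (M * N) -> Prop :=
| TRrefl s : tensor_rel s s
| TRsym s t : tensor_rel s t -> tensor_rel t s
| TRtrans s t u : tensor_rel s t -> tensor_rel t u -> tensor_rel s u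
| TRcat s s' t t' : tensor_rel s s' -> tensor_rel t t' ->
    tensor_rel (s ++ t) (s' ++ t')
| TRcatC s t : tensor_rel (s ++ t) (t ++ s)
| TRzero x : tensor_rel [:: (0, x)] [::]
| TRaddl x x' y : tensor_rel [:: (x + x', y)] [:: (x, y); (x', y)]
| TRaddr x y y' : tensor_rel [:: (x, y + y')] [:: (x, y); (x, y')]
| TRbal x a y : A a -> tensor_rel [:: (ract x a, y)] [:: (x, lact a y)].

Definition tensor_eqb : rel (seq (M * N)) := fun s t => `[< tensor_rel s t >].

Fact tensor_eqb_refl : reflexive tensor_eqb.
Proof. by move=> s; apply/asboolP; apply: TRrefl. Qed.
Fact tensor_eqb_sym s t : tensor_eqb s t = tensor_eqb t s.
Proof. by apply/asboolP/asboolP; apply: TRsym. Qed.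
Fact tensor_eqb_trans : transitive tensor_eqb.
Proof.
by move=> t s u /asboolP H1 /asboolP H2; apply/asboolP; apply: TRtrans H1 H2.
Qed.

Canonical tensor_equiv :=
  EquivRel tensor_eqb tensor_eqb_refl tensor_eqb_sym tensor_eqb_trans.

Definition tensor_car : Type := {eq_quot tensor_equiv}.
HB.instance Definition _ := Choice.on tensor_car.
HB.instance Definition _ := EqQuotient.on tensor_car.

Let T := tensor_car.
Let cls (s : seq (M * N)) : T := \pi_T s.

Lemma clsP s t : cls s = cls t <-> tensor_rel s t.
Proof.
split=> [/eqP|H]; first by rewrite eqmodE => /asboolP.
by apply/eqP; rewrite eqmodE; apply/asboolP.
Qed.

Lemma cls_repr (x : T) : cls (repr x) = x.
Proof. exact: reprK. Qed.

Lemma repr_cls s : tensor_rel (repr (cls s)) s.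
Proof. by apply/clsP; rewrite cls_repr. Qed.

Definition tzero : T := cls [::].
Definition tadd (x y : T) : T := cls (repr x ++ repr y).
Definition topp (x : T) : T := cls [seq (- p.1, p.2) | p <- repr x].

Lemma cls_cat s t : cls (s ++ t) = tadd (cls s) (cls t).
Proof.
by apply/clsP; apply: TRcat; apply: TRsym; apply: repr_cls.
Qed.

Fact taddA : associative tadd.
Proof.
move=> x y z; rewrite -[x]cls_repr -[y]cls_repr -[z]cls_repr.
by rewrite -!cls_cat catA.
Qed.
Fact taddC : commutative tadd.
Proof. by move=> x y; apply/clsP/TRcatC. Qed.
Fact tadd0 : left_id tzero tadd.
Proof. by move=> x; rewrite -[x]cls_repr -cls_cat. Qed.
Lemma taddACA : interchange tadd tadd.
Proof. by move=> x y z t; rewrite !taddA -(taddA x) (taddC y) taddA. Qed.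
Fact taddN : left_inverse tzero topp tadd.
Proof.
move=> x; rewrite -{2}[x]cls_repr /topp -cls_cat.
elim: (repr x) => //= -[y z] s IH; set s' := map _ s in IH *.
rewrite -[LHS]/(cls (([:: (- y, z)] ++ s') ++ ([:: (y, z)] ++ s))).
rewrite 3!cls_cat taddACA -(cls_cat s') IH taddC tadd0 -cls_cat.
rewrite (_ : cls _ = cls [:: (- y + y, z)]); last exact/clsP/TRsym/TRaddl.
by rewrite addNr; apply/clsP/TRzero.
Qed.

HB.instance Definition _ := GRing.isZmodule.Build tensor_car taddA taddC tadd0 taddN.

Definition tpure (x : M) (y : N) : T := cls [:: (x, y)].

Lemma tpureDl x x' y : tpure (x + x') y = tpure x y + tpure x' y.
Proof. by rewrite -[RHS]cls_cat; apply/clsP/TRaddl. Qed.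
Lemma tpureDr x y y' : tpure x (y + y') = tpure x y + tpure x y'.
Proof. by rewrite -[RHS]cls_cat; apply/clsP/TRaddr. Qed.
Lemma tpure_bal x a y : A a -> tpure (ract x a) y = tpure x (lact a y).
Proof. by move=> Ha; apply/clsP/TRbal. Qed.
Lemma tpure0l y : tpure 0 y = 0.
Proof. by apply: (@addrI _ (tpure 0 y)); rewrite -tpureDl !addr0. Qed.
Lemma tpure0r x : tpure x 0 = 0.
Proof. by apply: (@addrI _ (tpure x 0)); rewrite -tpureDr !addr0. Qed.
Lemma tpureNl x y : tpure (- x) y = - tpure x y.
Proof. by apply: (@addrI _ (tpure x y)); rewrite -tpureDl !subrr tpure0l. Qed.

Lemma cls_sum s : cls s = \sum_(p <- s) tpure p.1 p.2.
Proof.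
elim: s => [|[x y] s IH]; first by rewrite big_nil.
by rewrite big_cons -cat1s cls_cat -IH.
Qed.

Lemma tensor_ind (P : T -> Prop) :
  P 0 -> (forall x y, P x -> P y -> P (x + y)) ->
  (forall x y, P (tpure x y)) -> forall t, P t.
Proof.
move=> P0 PD Pp t; rewrite -[t]cls_repr cls_sum.
by elim: (repr t) => [|p s IH]; rewrite ?big_nil ?big_cons //; apply: PD.
Qed.

Section Lift.
Variable Z : zmodType.
Implicit Type h : M -> N -> Z.

Definition balanced h : Prop :=
  [/\ forall x x' y, h (x + x') y = h x y + h x' y,
      forall x y y', h x (y + y') = h x y + h x y'
    & forall x a y, A a -> h (ract x a) y = h x (lact a y)].

Definition tlift h (t : T) : Z := \sum_(p <- repr t) h p.1 p.2.

Lemma tlift_cls h s : balanced h -> tlift h (cls s) = \sum_(p <- s) h p.1 p.2.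
Proof.
move=> [hl hr hb]; rewrite /tlift.
suff rel_sum s1 s2 : tensor_rel s1 s2 ->
    \sum_(p <- s1) h p.1 p.2 = \sum_(p <- s2) h p.1 p.2.
  exact/rel_sum/repr_cls.
elim=> {s1 s2} [//|s1 s2 _ -> //|s1 s2 s3 _ -> _ -> //||||||].
- by move=> s1 s1' s2 s2' _ IH1 _ IH2; rewrite !big_cat IH1 IH2.
- by move=> s1 s2; rewrite !big_cat /= addrC.
- move=> y; rewrite big_seq1 big_nil /=.
  by apply: (@addrI _ (h 0 y)); rewrite -hl !addr0.
- by move=> x x' y; rewrite big_seq1 big_cons big_seq1 /= hl.
- by move=> x y y'; rewrite big_seq1 big_cons big_seq1 /= hr.
- by move=> x a y Ha; rewrite !big_seq1 /= hb.
Qed.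

Lemma tliftE h x y : balanced h -> tlift h (tpure x y) = h x y.
Proof. by move=> Hh; rewrite tlift_cls // big_seq1. Qed.

Lemma tliftD h s t : balanced h -> tlift h (s + t) = tlift h s + tlift h t.
Proof.
move=> Hh; rewrite -[s]cls_repr -[t]cls_repr -[_ + _]cls_cat !tlift_cls //.
by rewrite big_cat.
Qed.

Lemma tlift0 h : balanced h -> tlift h 0 = 0.
Proof. by move=> Hh; apply: (@addrI _ (tlift h 0)); rewrite -tliftD // !addr0. Qed.

Lemma tliftB h s t : balanced h -> tlift h (s - t) = tlift h s - tlift h t.
Proof.
by move=> Hh; apply: (@addIr _ (tlift h t)); rewrite -tliftD // !subrK.
Qed.

Lemma tlift_addf h h' t : tlift (fun x y => h x y + h' x y) t = tlift h t + tlift h' t.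
Proof. exact: big_split. Qed.

Lemma tlift_0f t : tlift (fun _ _ => 0) t = 0.
Proof. exact: big1. Qed.

Lemma tlift_eq h h' t : (forall x y, h x y = h' x y) -> tlift h t = tlift h' t.
Proof. by move=> E; apply: eq_bigr. Qed.
End Lift.

Definition tlact p : T -> T := tlift (fun x y => tpure (lact p x) y).
Definition tract (t : T) p : T := tlift (fun x y => tpure x (ract y p)) t.

Inductive tdeg : int -> T -> Prop :=
| tdeg0 i : tdeg i 0
| tdegB i s t : tdeg i s -> tdeg i t -> tdeg i (s - t)
| tdeg_pure i j x y : bdeg i x -> bdeg j y -> tdeg (i + j) (tpure x y).

Fact balanced_lact p : balanced (fun x y => tpure (lact p x) y).
Proof.
split=> *; first by rewrite lactDr tpureDl.
  by rewrite tpureDr.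
by rewrite -lractA tpure_bal.
Qed.

Fact balanced_ract p : balanced (fun x y => tpure x (ract y p)).
Proof.
split=> *; first by rewrite tpureDl.
  by rewrite ractDl tpureDr.
by rewrite lractA tpure_bal.
Qed.

Lemma tlact_pure p x y : tlact p (tpure x y) = tpure (lact p x) y.
Proof. by rewrite /tlact tliftE //; apply: balanced_lact. Qed.
Lemma tract_pure x y p : tract (tpure x y) p = tpure x (ract y p).
Proof. by rewrite /tract tliftE //; apply: balanced_ract. Qed.

Fact tlactDr p s t : tlact p (s + t) = tlact p s + tlact p t.
Proof. exact/tliftD/balanced_lact. Qed.
Fact tractDl s t p : tract (s + t) p = tract s p + tract t p.
Proof. exact/tliftD/balanced_ract. Qed.
Lemma tlactr0 p : tlact p 0 = 0.
Proof. by apply: (@addrI _ (tlact p 0)); rewrite -tlactDr !addr0. Qed.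
Lemma tractl0 p : tract 0 p = 0.
Proof. by apply: (@addrI _ (tract 0 p)); rewrite -tractDl !addr0. Qed.
Lemma tlactrB p s t : tlact p (s - t) = tlact p s - tlact p t.
Proof. by apply: (@addIr _ (tlact p t)); rewrite -tlactDr !subrK. Qed.
Lemma tractlB s t p : tract (s - t) p = tract s p - tract t p.
Proof. by apply: (@addIr _ (tract t p)); rewrite -tractDl !subrK. Qed.

Fact tlactDl p q t : tlact (p + q) t = tlact p t + tlact q t.
Proof.
by rewrite -tlift_addf; apply: tlift_eq => x y; rewrite lactDl tpureDl.
Qed.
Fact tractDr t p q : tract t (p + q) = tract t p + tract t q.
Proof.
by rewrite -tlift_addf; apply: tlift_eq => x y; rewrite ractDr tpureDr.
Qed.
Fact tlactA p q t : tlact p (tlact q t) = tlact (p * q) t.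
Proof.
elim/tensor_ind: t => [|s t Hs Ht|x y]; first by rewrite !tlactr0.
  by rewrite !tlactDr Hs Ht.
by rewrite !tlact_pure lactA.
Qed.
Fact tractA t p q : tract (tract t p) q = tract t (p * q).
Proof.
elim/tensor_ind: t => [|s t Hs Ht|x y]; first by rewrite !tractl0.
  by rewrite !tractDl Hs Ht.
by rewrite !tract_pure ractA.
Qed.
Fact tlact1 t : tlact 1 t = t.
Proof.
elim/tensor_ind: t => [|s t Hs Ht|x y]; first by rewrite tlactr0.
  by rewrite tlactDr Hs Ht.
by rewrite tlact_pure lact1.
Qed.
Fact tract1 t : tract t 1 = t.
Proof.
elim/tensor_ind: t => [|s t Hs Ht|x y]; first by rewrite tractl0.
  by rewrite tractDl Hs Ht.
by rewrite tract_pure ract1.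
Qed.
Fact tlractA p t q : tract (tlact p t) q = tlact p (tract t q).
Proof.
elim/tensor_ind: t => [|s t Hs Ht|x y].
- by rewrite tlactr0 tractl0 tlactr0.
- by rewrite tlactDr !tractDl tlactDr Hs Ht.
- by rewrite tlact_pure !tract_pure tlact_pure.
Qed.
Fact tdeg_lact i j p t : rdeg i p -> tdeg j t -> tdeg (i + j) (tlact p t).
Proof.
move=> Hp; elim=> [k|k s t' _ IHs _ IHt|k l x y Hx Hy].
- by rewrite tlactr0; apply: tdeg0.
- by rewrite tlactrB; apply: tdegB.
- by rewrite tlact_pure addrA; apply: tdeg_pure Hy; apply: bdeg_lact.
Qed.
Fact tdeg_ract i j t p : tdeg i t -> rdeg j p -> tdeg (i + j) (tract t p).
Proof.
move=> Ht Hp; elim: Ht => [k|k s t' _ IHs _ IHt|k l x y Hx Hy].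
- by rewrite tractl0; apply: tdeg0.
- by rewrite tractlB; apply: tdegB.
- by rewrite tract_pure -addrA; apply: tdeg_pure Hx _; apply: bdeg_ract.
Qed.

Definition tensor : bimod :=
  @Bimod T tlact tract tdeg tlactDr tlactDl tlactA tlact1 tractDl tractDr
    tractA tract1 tlractA tdeg0 tdegB tdeg_lact tdeg_ract.

Lemma tlift_homdeg (B : bimod) k (h : M -> N -> B) :
  balanced h ->
  (forall p x y, h (lact p x) y = lact p (h x y)) ->
  (forall x y p, h x (ract y p) = ract (h x y) p) ->
  (forall i j x y, bdeg i x -> bdeg j y -> bdeg (i + j + k) (h x y)) ->
  homdeg k (tlift h : tensor -> B).
Proof.
move=> Hh hl hr hd.
have H0 := tlift0 Hh.
split; [split=> [s t|p t|t p]|].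
- exact: tliftD.
- elim/tensor_ind: t => [|s t Hs Ht|x y].
  + by rewrite (lactr0 tensor p) H0 lactr0.
  + by rewrite (@lactDr tensor) !tliftD // Hs Ht lactDr.
  + by rewrite [lact p _]tlact_pure !tliftE.
- elim/tensor_ind: t => [|s t Hs Ht|x y].
  + by rewrite (ractl0 tensor p) H0 ractl0.
  + by rewrite (@ractDl tensor) !tliftD // Hs Ht ractDl.
  + by rewrite [ract _ p]tract_pure !tliftE.
- move=> i t; elim=> [j|j s t' _ IHs _ IHt|j l x y Hx Hy].
  + by rewrite H0; apply: bdeg0.
  + by rewrite tliftB //; apply: bdegB.
  + by rewrite tliftE //; apply: hd.
Qed.
End Tensor.

Definition regular : bimod :=
  @Bimod R *%R *%R rdeg (fun p => mulrDr p) (fun p q x => mulrDl p q x)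
    (fun p q x => mulrA p q x) (@mul1r _) (fun x y p => mulrDl x y p)
    (fun x => mulrDr x) (fun x p q => esym (mulrA x p q)) (@mulr1 _)
    (fun p x q => esym (mulrA p x q)) (fun i => or_introl erefl) rdegB
    rdegM rdegM.

(* The residue field K = R / R^+ as a trivial bimodule in degree 0. *)
Definition resdeg (i : int) (c : K) : Prop := i = 0 \/ c = 0.
Fact resdegB i c d : resdeg i c -> resdeg i d -> resdeg i (c - d).
Proof.
by case=> [->|->]; [left | case=> [->|->]; [left | right; rewrite subrr]].
Qed.
Fact mcoeff0_rdeg i p : rdeg i p -> i = 0 \/ p@_0%MM = 0.
Proof.
case=> [->|[[|d] -> Hp]]; first by right; rewrite mcoeff0.
  by left.
by right; apply: (dhomog_nemf_coeff Hp); rewrite mf0.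
Qed.
Fact resdeg_lact i j p c :
  rdeg i p -> resdeg j c -> resdeg (i + j) (p@_0%MM * c).
Proof.
move=> /mcoeff0_rdeg [->|->]; last by right; rewrite mul0r.
by case=> [->|->]; [left | right; rewrite mulr0].
Qed.
Fact resdeg_ract i j c p :
  resdeg i c -> rdeg j p -> resdeg (i + j) (c * p@_0%MM).
Proof. by rewrite addrC mulrC => Hc Hp; apply: resdeg_lact. Qed.
Fact mcoeff0M (p q : R) : (p * q)@_0%MM = p@_0%MM * q@_0%MM.
Proof. exact: rmorphM. Qed.

Program Definition residue : bimod :=
  @Bimod K (fun p c => p@_0%MM * c) (fun c p => c * p@_0%MM) resdeg
    _ _ _ _ _ _ _ _ _ (fun i => or_intror erefl) resdegB
    resdeg_lact resdeg_ract.
Next Obligation. by rewrite mulrDr. Qed.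
Next Obligation. by rewrite mcoeffD mulrDl. Qed.
Next Obligation. by rewrite mcoeff0M mulrA. Qed.
Next Obligation. by rewrite mcoeff1 eqxx mul1r. Qed.
Next Obligation. by rewrite mulrDl. Qed.
Next Obligation. by rewrite mcoeffD mulrDr. Qed.
Next Obligation. by rewrite mcoeff0M mulrA. Qed.
Next Obligation. by rewrite mcoeff1 eqxx mulr1. Qed.
Next Obligation. by rewrite mulrA. Qed.

Lemma homdeg_shift k l (B B' : bimod) (f : B -> B') :
  homdeg k f -> homdeg k (f : bshift l B -> bshift l B').
Proof. by move=> [Hf df]; split=> // i x Hx; rewrite /= addrA; apply: df. Qed.

Lemma homZ_shift l (B B' : bimod) (f : B -> B') :
  homZ f -> homZ (f : bshift l B -> bshift l B').
Proof.
by elim=> [|k {}f f' Hf _ IH]; [apply: homZ0 | apply: homZD (homdeg_shift l Hf) IH].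
Qed.

Lemma homdeg_shiftl k l (B B' : bimod) (f : B -> B') :
  homdeg k f -> homdeg (k + l) (f : bshift l B -> B').
Proof.
move=> [Hf df]; split=> // i x Hx.
by rewrite addrCA addrC addrAC addrC addrA; apply: df.
Qed.

Section TensorMaps.
Variable A : R -> Prop.

Section Right.
Variables P M M' : bimod.

Definition tmapr (f : M -> M') : tensor A P M -> tensor A P M' :=
  tlift (fun x y => tpure A x (f y)).

Lemma balanced_tmapr (f : M -> M') :
  bimor f -> balanced A (fun (x : P) y => tpure A x (f y)).
Proof.
move=> [fD fl fr]; split=> *; first by rewrite tpureDl.
  by rewrite fD tpureDr.
by rewrite fl tpure_bal.
Qed.

Lemma tmapr_pure (f : M -> M') x y : bimor f -> tmapr f (tpure A x y) = tpure A x (f y).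
Proof. by move=> Hf; rewrite /tmapr tliftE //; apply: balanced_tmapr. Qed.

Lemma tmapr_homdeg k (f : M -> M') : homdeg k f -> homdeg k (tmapr f).
Proof.
move=> [Hf df]; apply: tlift_homdeg; first exact: balanced_tmapr.
- by move=> p x y; rewrite [RHS]tlact_pure.
- by move=> x y p; rewrite [RHS]tract_pure; case: Hf => _ _ ->.
- by move=> i j x y Hx Hy; rewrite -addrA; apply: tdeg_pure Hx (df _ _ Hy).
Qed.

Lemma tmapr_homZ (f : M -> M') : homZ f -> homZ (tmapr f).
Proof.
elim=> [|k {}f g Hf _ IH].
  rewrite (_ : tmapr 0 = 0); first exact: homZ0.
  apply/funext=> t; rewrite -[RHS](tlift_0f _ t); apply: tlift_eq => x y.
  exact: tpure0r.
rewrite (_ : tmapr (f + g) = tmapr f + tmapr g).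
  exact: homZD (tmapr_homdeg Hf) IH.
apply/funext=> t; rewrite /tmapr -[RHS]tlift_addf; apply: tlift_eq => x y.
exact: tpureDr.
Qed.
End Right.

Section Left.
Variables M M' P : bimod.

Definition tmapl (f : M -> M') : tensor A M P -> tensor A M' P :=
  tlift (fun x y => tpure A (f x) y).

Lemma balanced_tmapl (f : M -> M') :
  bimor f -> balanced A (fun x (y : P) => tpure A (f x) y).
Proof.
move=> [fD fl fr]; split=> *; first by rewrite fD tpureDl.
  by rewrite tpureDr.
by rewrite fr tpure_bal.
Qed.

Lemma tmapl_pure (f : M -> M') x y : bimor f -> tmapl f (tpure A x y) = tpure A (f x) y.
Proof. by move=> Hf; rewrite /tmapl tliftE //; apply: balanced_tmapl. Qed.

Lemma tmapl_homdeg k (f : M -> M') : homdeg k f -> homdeg k (tmapl f).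
Proof.
move=> [Hf df]; apply: tlift_homdeg; first exact: balanced_tmapl.
- by move=> p x y; rewrite [RHS]tlact_pure; case: Hf => _ -> _.
- by move=> x y p; rewrite [RHS]tract_pure.
- by move=> i j x y Hx Hy; rewrite addrAC; apply: tdeg_pure (df _ _ Hx) Hy.
Qed.

Lemma tmapl_homZ (f : M -> M') : homZ f -> homZ (tmapl f).
Proof.
elim=> [|k {}f g Hf _ IH].
  rewrite (_ : tmapl 0 = 0); first exact: homZ0.
  apply/funext=> t; rewrite -[RHS](tlift_0f _ t); apply: tlift_eq => x y.
  exact: tpure0l.
rewrite (_ : tmapl (f + g) = tmapl f + tmapl g).
  exact: homZD (tmapl_homdeg Hf) IH.
apply/funext=> t; rewrite /tmapl -[RHS]tlift_addf; apply: tlift_eq => x y.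
exact: tpureDl.
Qed.
End Left.
End TensorMaps.

Notation tensorR := (tensor (fun _ => True)).
Notation tpureR := (tpure (fun _ => True)).

(* The canonical isomorphisms R (x)_R N = N and
   (P (x)_A M)(k) (x)_R N = (P (x)_A (M (x)_R N))(k). *)
Section Unitors.
Variable N : bimod.

Definition lunit : tensorR regular N -> N := tlift (fun (p : regular) (y : N) => lact (p : R) y).
Definition lunit_inv (y : N) : tensorR regular N := tpureR (1 : regular) y.

Lemma balanced_lunit : balanced (fun _ => True) (fun (p : regular) (y : N) => lact (p : R) y).
Proof.
by split=> *; [rewrite lactDl | rewrite lactDr | rewrite lactA].
Qed.

Lemma lunit_homdeg : homdeg 0 lunit.
Proof.
apply: tlift_homdeg; first exact: balanced_lunit.
- by move=> p x y; rewrite lactA.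
- by move=> x y p; rewrite lractA.
- by move=> i j x y Hx Hy; rewrite addr0; apply: bdeg_lact.
Qed.

Lemma lunitK : cancel lunit lunit_inv.
Proof.
move=> t; elim/tensor_ind: t => [|t t' Ht Ht'|p y].
- rewrite /lunit tlift0; last exact: balanced_lunit.
  exact: tpure0r.
- rewrite /lunit tliftD; last exact: balanced_lunit.
  by rewrite /lunit_inv tpureDr; congr (_ + _).
- rewrite /lunit tliftE; last exact: balanced_lunit.
  by rewrite /lunit_inv -tpure_bal //; congr tpure; apply: mul1r.
Qed.

Lemma lunit_invK : cancel lunit_inv lunit.
Proof. by move=> y; rewrite /lunit tliftE ?lact1 //; apply: balanced_lunit. Qed.

Lemma lunit_inv_homdeg : homdeg 0 lunit_inv.
Proof.
split; first split=> [x y|p x|x p].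
- exact: tpureDr.
- rewrite /lunit_inv [RHS]tlact_pure -tpure_bal //; congr tpure.
  by rewrite /= mul1r mulr1.
- by rewrite [RHS]tract_pure.
move=> i x Hx; rewrite addrC; apply: tdeg_pure Hx; right.
by exists 0%N => //; apply: dhomog1.
Qed.
End Unitors.

Section Associators.
Variables (A : R -> Prop) (k : int) (P M N : bimod).
Let Q := bshift k (tensor A P M).
Let L := tensorR Q N.
Let L' := bshift k (tensor A P (tensorR M N)).

Definition assocl_fun (x : P) (y : M) (z : N) : L :=
  @tpure (fun _ => True) Q N (tpure A x y) z.
Definition assocl : L' -> L :=
  tlift (fun (x : P) (t : tensorR M N) => tlift (assocl_fun x) t).
Definition assocr_fun (z : N) (x : P) (y : M) : L' :=
  @tpure A P (tensorR M N) x (tpureR y z).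
Definition assocr : L -> L' :=
  tlift (fun (t : Q) (z : N) => tlift (assocr_fun z) t).

Fact balanced_hl x : balanced (fun _ => True) (assocl_fun x).
Proof.
rewrite /assocl_fun; split=> *; first by rewrite tpureDr tpureDl.
  by rewrite tpureDr.
by rewrite -tpure_bal //= tract_pure.
Qed.

Fact balanced_hr z : balanced A (assocr_fun z).
Proof.
rewrite /assocr_fun; split=> *; first by rewrite tpureDl.
  by rewrite tpureDl tpureDr.
by rewrite tpure_bal //= tlact_pure.
Qed.

Fact balanced_assocl :
  balanced A (fun (x : P) (t : tensorR M N) => tlift (assocl_fun x) t).
Proof.
split=> [x x' t|x t t'|x a t Aa].
- rewrite -tlift_addf; apply: tlift_eq => y z.
  by rewrite /assocl_fun !tpureDl.
- exact/tliftD/balanced_hl.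
- elim/tensor_ind: t => [|t t' Ht Ht'|y z].
  + by rewrite (lactr0 (tensorR M N)) !tlift0 //; apply: balanced_hl.
  + rewrite (@lactDr (tensorR M N)) !tliftD ?Ht ?Ht' //; exact: balanced_hl.
  + rewrite [lact a _]tlact_pure !tliftE; try exact: balanced_hl.
    by rewrite /assocl_fun tpure_bal.
Qed.

Fact balanced_assocr :
  balanced (fun _ => True) (fun (t : Q) (z : N) => tlift (assocr_fun z) t).
Proof.
split=> [t t' z|t z z'|t a z _].
- exact/tliftD/balanced_hr.
- rewrite -tlift_addf; apply: tlift_eq => x y.
  by rewrite /assocr_fun !tpureDr.
- elim/tensor_ind: t => [|t t' Ht Ht'|x y].
  + by rewrite (ractl0 Q) !tlift0 //; apply: balanced_hr.
  + rewrite (@ractDl Q) !tliftD ?Ht ?Ht' //; exact: balanced_hr.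
  + rewrite [ract _ a]tract_pure !tliftE; try exact: balanced_hr.
    by rewrite /assocr_fun tpure_bal.
Qed.

Lemma assocl_pure x y z :
  assocl (@tpure A P (tensorR M N) x (tpureR y z)) = assocl_fun x y z.
Proof.
rewrite /assocl tliftE; last exact: balanced_assocl.
by rewrite tliftE //; apply: balanced_hl.
Qed.

Lemma assocr_pure x y z : assocr (assocl_fun x y z) = assocr_fun z x y.
Proof.
rewrite /assocr tliftE; last exact: balanced_assocr.
by rewrite tliftE //; apply: balanced_hr.
Qed.

Lemma assoclK : cancel assocl assocr.
Proof.
have aD t t' : assocl (t + t') = assocl t + assocl t'.
  exact/tliftD/balanced_assocl.
have bD t t' : assocr (t + t') = assocr t + assocr t'.
  exact/tliftD/balanced_assocr.
move=> u; elim/tensor_ind: u => [|u u' Hu Hu'|x t].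
- rewrite /assocl tlift0; last exact: balanced_assocl.
  by rewrite /assocr tlift0 //; apply: balanced_assocr.
- by rewrite aD bD Hu Hu'.
elim/tensor_ind: t => [|t t' Ht Ht'|y z].
- rewrite [tpure A x 0]tpure0r /assocl tlift0; last exact: balanced_assocl.
  by rewrite /assocr tlift0 //; apply: balanced_assocr.
- by rewrite [tpure A x _]tpureDr aD bD Ht Ht'.
- by rewrite assocl_pure assocr_pure.
Qed.

Lemma assocrK : cancel assocr assocl.
Proof.
have aD t t' : assocl (t + t') = assocl t + assocl t'.
  exact/tliftD/balanced_assocl.
have bD t t' : assocr (t + t') = assocr t + assocr t'.
  exact/tliftD/balanced_assocr.
move=> u; elim/tensor_ind: u => [|u u' Hu Hu'|t z].
- rewrite /assocr tlift0; last exact: balanced_assocr.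
  by rewrite /assocl tlift0 //; apply: balanced_assocl.
- by rewrite bD aD Hu Hu'.
elim/tensor_ind: t => [|t t' Ht Ht'|x y].
- rewrite [tpure _ 0 z]tpure0l /assocr tlift0; last exact: balanced_assocr.
  by rewrite /assocl tlift0 //; apply: balanced_assocl.
- by rewrite [tpure _ _ z]tpureDl bD aD Ht Ht'.
- exact: etrans (congr1 assocl (assocr_pure x y z)) (assocl_pure x y z).
Qed.

Lemma assocl_homdeg : homdeg 0 assocl.
Proof.
rewrite -[0](addNr k); apply: homdeg_shiftl.
apply: tlift_homdeg; first exact: balanced_assocl.
- move=> p x t; elim/tensor_ind: t => [|t t' Ht Ht'|y z].
  + by rewrite !tlift0 ?(lactr0 L) //; apply: balanced_hl.
  + rewrite !tliftD ?Ht ?Ht' ?(@lactDr L) //; exact: balanced_hl.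
  + rewrite !tliftE; try exact: balanced_hl.
    rewrite /assocl_fun [RHS]tlact_pure; congr tpure.
    exact/esym/tlact_pure.
- move=> x t p; elim/tensor_ind: t => [|t t' Ht Ht'|y z].
  + rewrite (ractl0 (tensorR M N)) !tlift0 ?(ractl0 L) //; exact: balanced_hl.
  + rewrite (@ractDl (tensorR M N)) !tliftD ?Ht ?Ht' ?(@ractDl L) //;
      exact: balanced_hl.
  + rewrite [ract _ p]tract_pure !tliftE; try exact: balanced_hl.
    by rewrite /assocl_fun [RHS]tract_pure.
- move=> i j x t Hx; elim=> [a|a s t' _ IHs _ IHt|a b y z Hy Hz].
  + rewrite tlift0; [exact: tdeg0 | exact: balanced_hl].
  + rewrite tliftB; [exact: tdegB | exact: balanced_hl].
  + rewrite tliftE; last exact: balanced_hl.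
    rewrite (_ : i + (a + b) + - k = i + a - k + b); last first.
      by rewrite addrA [LHS]addrAC.
    apply: (@tdeg_pure _ Q N) => //=.
    by rewrite [k + _]addrC subrK; apply: tdeg_pure.
Qed.

Lemma assocr_homdeg : homdeg 0 assocr.
Proof.
apply: tlift_homdeg; first exact: balanced_assocr.
- move=> p t z; elim/tensor_ind: t => [|t t' Ht Ht'|x y].
  + rewrite (lactr0 Q) !tlift0 ?(lactr0 L') //; exact: balanced_hr.
  + rewrite (@lactDr Q) !tliftD ?Ht ?Ht' ?(@lactDr L') //; exact: balanced_hr.
  + rewrite [lact p _]tlact_pure !tliftE; try exact: balanced_hr.
    by rewrite /assocr_fun [RHS]tlact_pure.
- move=> t z p; elim/tensor_ind: t => [|t t' Ht Ht'|x y].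
  + by rewrite !tlift0 ?(ractl0 L') //; apply: balanced_hr.
  + rewrite !tliftD ?Ht ?Ht' ?(@ractDl L') //; exact: balanced_hr.
  + rewrite !tliftE; try exact: balanced_hr.
    rewrite /assocr_fun [RHS]tract_pure; congr tpure.
    exact/esym/tract_pure.
- move=> i j t z Ht Hz; rewrite addr0 /= addrA; move: Ht => /=.
  elim=> [a|a s t' _ IHs _ IHt|a b x y Hx Hy].
  + rewrite tlift0; [exact: tdeg0 | exact: balanced_hr].
  + rewrite tliftB; [exact: tdegB | exact: balanced_hr].
  + rewrite tliftE; last exact: balanced_hr.
    by rewrite -addrA; apply: tdeg_pure Hx _; apply: tdeg_pure.
Qed.
End Associators.
End GradedBimodules.

Notation tensorR := (tensor (fun _ => True)).
Notation tpureR := (tpure (fun _ => True)).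

Definition wprod (W : groupType) (S : Type) (gen : S -> W) (e : seq S) : W :=
  foldr (fun s x => gen s * x)%g 1%g e.

Record coxeter_system (W : groupType) (S : Type) := CoxeterSystem {
  gen : S -> W;
  (* cox_m s t is the order of st, with 0 standing for infinity *)
  cox_m : S -> S -> nat;
  gen_inj : injective gen;
  gen_neq1 : forall s, gen s <> 1%g;
  gen_sq : forall s, (gen s * gen s = 1)%g;
  cox_mP : forall s t k, ((gen s * gen t) ^+ k = 1)%g <-> (cox_m s t %| k)%N;
  gen_span : forall x, exists e, wprod gen e = x;
  (* W is presented by the generators and the relations (st)^(m_st) = 1 *)
  cox_presentation : forall (H : groupType) (h : S -> H),
    (forall s t, ((h s * h t) ^+ cox_m s t = 1)%g) ->
    exists2 phi : W -> H,
      (forall x y, phi (x * y) = phi x * phi y)%g & forall s, phi (gen s) = h s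
}.

Section CoxeterTheory.
Variables (W : groupType) (S : Type) (C : coxeter_system W S).

Fact length_ex x : exists k, `[< exists e, size e = k /\ wprod (gen C) e = x >].
Proof. by have [e He] := gen_span C x; exists (size e); apply/asboolP; exists e. Qed.

Definition cox_length (x : W) : nat := ex_minn (length_ex x).

Definition reduced (e : seq S) : bool := size e == cox_length (wprod (gen C) e).

Definition reflection (x : W) : Prop := exists s y, (x = y * gen C s * y^-1)%g.

Inductive bruhat (x : W) : W -> Prop :=
| bruhat_refl : bruhat x x
| bruhat_step y t of bruhat x y & reflection t &
    (cox_length y < cox_length (y * t)%g)%N : bruhat x (y * t)%g.

(* s t s t ... (k letters) *)
Fixpoint alternating (k : nat) (s t : S) : seq S :=
  if k is k'.+1 then s :: alternating k' t s else [::].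

Inductive braid_seq : seq S -> seq S -> Type :=
| braid_nil e : braid_seq e e
| braid_cons x s t y e of s <> t & (0 < cox_m C s t)%N &
    braid_seq (x ++ alternating (cox_m C s t) t s ++ y) e :
    braid_seq (x ++ alternating (cox_m C s t) s t ++ y) e.
End CoxeterTheory.

(* Reflection-faithful representations, with chosen equations eqn s of the
   hyperplanes fixed by the generators. *)
Record reflection_faithful (K : realType) (V : vectType K)
    (W : groupType) (S : Type) (C : coxeter_system W S) := ReflectionFaithful {
  rep : W -> 'End(V);
  rep1 : rep 1%g = \1%VF;
  repM : forall x y, rep (x * y)%g = (rep x \o rep y)%VF;
  rep_inj : injective rep;
  rep_refl : forall x,
    (\dim (fixedSpace (rep x))).+1 = \dim {:V} <-> reflection C x;
  eqn : S -> 'Hom(V, K^o);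
  eqn_ker : forall s, lker (eqn s) = fixedSpace (rep (gen C s))
}.

Section Realization.
Variables (K : realType) (V : vectType K) (W : groupType) (S : Type).
Variables (C : coxeter_system W S) (rho : reflection_faithful V C).
Local Notation n := (\dim {:V}).
Local Notation R := {mpoly K[n]}.
Local Notation g := (gen C).
Local Notation bimod := (bimod K n).
Local Notation basis := (vbasis {:V}).

(* R is the ring of polynomial functions on V: 'X_i is the i-th coordinate
   function of the basis above. *)
Definition linform (l : V -> K) : R := \sum_(i < n) l basis`_i *: 'X_i.

(* (x . p)(v) = p(x^-1 v) *)
Definition act (x : W) (p : R) : R :=
  p \mPo [tuple linform (fun v => coord basis i (rep rho x^-1%g v)) | i < n].

Definition eqnR (s : S) : R := linform (eqn rho s).

Lemma actD x p q : act x (p + q) = act x p + act x q.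
Proof. exact: comp_mpolyD. Qed.
Lemma actM x p q : act x (p * q) = act x p * act x q.
Proof. exact: rmorphM. Qed.
Lemma act1 x : act x 1 = 1.
Proof. exact: rmorph1. Qed.
Lemma act0 x : act x 0 = 0.
Proof. exact: raddf0. Qed.
Lemma actB x p q : act x (p - q) = act x p - act x q.
Proof. exact: raddfB. Qed.
Lemma actZ x c p : act x (c *: p) = c *: act x p.
Proof. exact: comp_mpolyZ. Qed.

Lemma actX x i : act x 'X_i = linform (fun v => coord basis i (rep rho x^-1%g v)).
Proof. by rewrite /act comp_mpolyXU nth_mktuple. Qed.

Lemma act_linform x (l : {linear V -> K^o}) :
  act x (linform l) = linform (fun v => l (rep rho x^-1%g v)).
Proof.
rewrite /linform /act raddf_sum /=.
under eq_bigr => i _ do rewrite comp_mpolyZ comp_mpolyXU nth_mktuple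
  /linform scaler_sumr.
rewrite exchange_big /=; apply: eq_bigr => j _.
under eq_bigr => i _ do rewrite scalerA.
rewrite -scaler_suml; congr (_ *: _).
rewrite {2}(coord_vbasis (memvf (rep rho x^-1%g basis`_j))) linear_sum /=.
by apply: eq_bigr => i _; rewrite linearZ /= mulrC.
Qed.

Lemma act_actX x y i : act x (act y 'X_i) = act (x * y)%g 'X_i.
Proof.
rewrite !actX (act_linform x (coord basis i \o rep rho y^-1%g)).
by congr linform; apply/funext=> v; rewrite /= invgM repM lfunE.
Qed.

(* Properties of homogeneous polynomials are checked on the variables. *)
Lemma rdeg_ind (P : int -> R -> Prop) :
  (forall i, P i 0) -> (forall i p q, P i p -> P i q -> P i (p + q)) ->
  (forall i c p, P i p -> P i (c *: p)) -> P 0 1 ->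
  (forall i j p q, P i p -> P j q -> P (i + j) (p * q)) ->
  (forall i, P 2 'X_i) -> forall i p, rdeg i p -> P i p.
Proof.
move=> P0 PD PZ P1 PM PX i p [-> //|[d -> Hp]].
have PXn k j : P (k.*2)%:Z ('X_j ^+ k).
  elim: k => [|k IH]; first by rewrite expr0.
  by rewrite exprS doubleS -addn2 addnC PoszD; apply: PM.
have Pm (m : 'X_{1..n}) : P (mdeg m).*2%:Z 'X_[m].
  rewrite mpolyXE_id (_ : _%:Z = \sum_(j < n) ((m j).*2)%:Z).
    by apply: (big_ind2 (fun p i => P i p)) => // p1 i1 p2 i2; apply: PM.
  rewrite mdegE -mul2n big_distrr /= (big_morph Posz PoszD (erefl _)).
  by apply: eq_bigr => j _; rewrite mul2n.
rewrite [p]mpolyE big_seq; apply: (big_ind (P _)) => [||m Hm].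
- exact: P0.
- exact: PD.
- by apply: PZ; rewrite -(dhomog_mf Hp Hm); apply: Pm.
Qed.

Lemma rdegD i (p q : R) : rdeg i p -> rdeg i q -> rdeg i (p + q).
Proof. exact: (@bdegD _ _ (regular K n)). Qed.

Lemma rdegZ i c (p : R) : rdeg i p -> rdeg i (c *: p).
Proof.
case=> [->|[d -> Hp]]; first by left; rewrite scaler0.
by right; exists d => //; apply: dhomogZ.
Qed.

Lemma rdegX i : rdeg 2 ('X_i : R).
Proof. by right; exists 1%N => //; rewrite dhomogX /= mdeg1. Qed.

Lemma rdeg1 : rdeg 0 (1 : R).
Proof. by right; exists 0%N => //; apply: dhomog1. Qed.

Lemma rdeg_linform l : rdeg 2 (linform l).
Proof.
apply: (big_ind (rdeg 2)) => [||i _]; first by left.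
  exact: rdegD.
exact/rdegZ/rdegX.
Qed.

Lemma rdeg_act x i p : rdeg i p -> rdeg i (act x p).
Proof.
move: i p; apply: rdeg_ind => [i|i p q|i c p||i j p q|i].
- by left; rewrite act0.
- by rewrite actD; apply: rdegD.
- by rewrite actZ; apply: rdegZ.
- by rewrite act1; apply: rdeg1.
- by rewrite actM; apply: rdegM.
- by rewrite actX; apply: rdeg_linform.
Qed.

Lemma act_act x y p : act x (act y p) = act (x * y)%g p.
Proof.
elim/mpoly_hom_ind: p => [|p q Hp Hq|i p].
- by rewrite !act0.
- by rewrite !actD Hp Hq.
move: i p; apply: rdeg_ind => [i|i p q Hp Hq|i c p Hp||i j p q Hp Hq|i].
- by rewrite !act0.
- by rewrite !actD Hp Hq.
- by rewrite !actZ Hp.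
- by rewrite !act1.
- by rewrite !actM Hp Hq.
- exact: act_actX.
Qed.

Lemma act_1 p : act 1%g p = p.
Proof.
elim/mpoly_hom_ind: p => [|p q Hp Hq|i p]; [by rewrite act0 | by rewrite actD Hp Hq|].
move: i p; apply: rdeg_ind => [i|i p q Hp Hq|i c p Hp||i j p q Hp Hq|i].
- by rewrite act0.
- by rewrite actD Hp Hq.
- by rewrite actZ Hp.
- by rewrite act1.
- by rewrite actM Hp Hq.
rewrite actX invg1 rep1 /linform (bigD1 i) //= big1 ?addr0 => [|j Hj].
  by rewrite lfunE /= coord_free ?eqxx ?scale1r //; apply: (basis_free (vbasisP _)).
rewrite lfunE /= coord_free; last exact: (basis_free (vbasisP _)).
by rewrite (negPf Hj) scale0r.
Qed.

Definition invariant_under (s : S) (p : R) : Prop := act (g s) p = p.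

Lemma gen_inv s : (g s)^-1%g = g s.
Proof. by apply/(@mulgI _ (g s)); rewrite mulgV gen_sq. Qed.

Lemma eqnR_neq0 s : eqnR s != 0.
Proof.
apply/negP=> /eqP Hs; apply: (@gen_neq1 _ _ C s); apply: (rep_inj (r := rho)).
rewrite rep1; apply/lfunP=> v; rewrite lfunE /=; apply/fixedSpaceP.
rewrite -eqn_ker memv_ker (coord_vbasis (memvf v)) linear_sum /= big1 // => i _.
rewrite linearZ /= (_ : eqn rho s _ = 0) ?scaler0 //.
have := congr1 (fun p => p@_U_(i)) Hs; rewrite mcoeff0 /eqnR /linform raddf_sum /=.
rewrite (bigD1 i) //= big1 ?addr0 => [|j Hj]; rewrite mcoeffZ mcoeffXU.
  by rewrite eqxx mulr1.
by rewrite (negPf Hj) mulr0.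
Qed.

Lemma eqnR_multiple s (d : {linear V -> K^o}) :
  (forall v, rep rho (g s) v = v -> d v = 0) ->
  exists c, linform d = c *: eqnR s.
Proof.
move=> Hd; suff [c Hc] : exists c, forall v, d v = c * (eqn rho s v : K).
  exists c; rewrite scaler_sumr; apply: eq_bigr => i _.
  by rewrite Hc scalerA.
have kerP v : eqn rho s v = 0 -> d v = 0.
  by move=> Hv; apply/Hd/fixedSpaceP; rewrite -eqn_ker memv_ker Hv.
have [H0|/existsNP [v0 /eqP Hv0]] := pselect (forall v, eqn rho s v = 0).
  by exists 0 => v; rewrite mul0r; apply: kerP.
exists (d v0 / eqn rho s v0) => v.
have : d (v - (eqn rho s v / eqn rho s v0) *: v0) = 0.
  by apply: kerP; rewrite linearB linearZ /= /GRing.scale /= divfK // subrr.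
rewrite linearB linearZ /= => /eqP; rewrite subr_eq0 => /eqP ->.
by rewrite /GRing.scale /= mulrAC [RHS]mulrAC (mulrC (d v0)).
Qed.

Lemma demazure_rdeg_ex s i p : rdeg i p ->
  exists2 q, rdeg (i - 2) q & p - act (g s) p = (eqnR s *+ 2) * q.
Proof.
suff H : rdeg i p -> rdeg i p /\
    exists2 q, rdeg (i - 2) q & p - act (g s) p = (eqnR s *+ 2) * q.
  by move/H => [].
move: i p; apply: rdeg_ind => [i|i p q|i c p||i j p q|i].
- by split; [left | exists 0; [left | rewrite act0 subrr mulr0]].
- move=> [Hp [p' Hp' Ep]] [Hq [q' Hq' Eq]]; split; first exact: rdegD.
  by exists (p' + q'); [apply: rdegD | rewrite actD opprD addrACA Ep Eq mulrDr].
- move=> [Hp [p' Hp' Ep]]; split; first exact: rdegZ.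
  by exists (c *: p'); [apply: rdegZ | rewrite actZ -scalerBr Ep scalerAr].
- by split; [exact: rdeg1 | exists 0; [left | rewrite act1 subrr mulr0]].
- move=> [Hp [p' Hp' Ep]] [Hq [q' Hq' Eq]]; split; first exact: rdegM.
  exists (p' * q + act (g s) p * q').
    apply: rdegD; first by rewrite addrAC; apply: rdegM.
    by rewrite -addrA; apply: rdegM => //; apply: rdeg_act.
  rewrite actM mulrDr (mulrA _ p') -Ep (mulrCA _ (act _ p)) -Eq mulrBl mulrBr.
  by rewrite addrA subrK.
- split; first exact: rdegX.
  pose d : {linear V -> K^o} := (coord basis i \- (coord basis i \o rep rho (g s))).
  have [v Hv|c Hc] := @eqnR_multiple s d.
    by rewrite /= Hv subrr.
  exists (c / 2%:R)%:MP; first by rewrite subrr -[X in rdeg _ X]mulr1 mul_mpolyC;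
    apply/rdegZ/rdeg1.
  rewrite -{1}[X in X - _]act_1 !actX gen_inv invg1 rep1.
  rewrite (_ : _ - _ = linform d); last first.
    rewrite /linform -sumrB; apply: eq_bigr => j _.
    by rewrite -scalerBl lfunE.
  rewrite Hc mulrC mul_mpolyC -scaler_nat scalerA divfK //.
  by rewrite pnatr_eq0.
Qed.

Lemma demazure_ex s p : exists q, p - act (g s) p = (eqnR s *+ 2) * q.
Proof.
elim/mpoly_hom_ind: p => [|p q [p' Ep] [q' Eq]|i p].
- by exists 0; rewrite act0 subrr mulr0.
- by exists (p' + q'); rewrite actD opprD addrACA Ep Eq mulrDr.
- by move=> /(demazure_rdeg_ex s) [q _ Eq]; exists q.
Qed.

(* (p - s . p) / (2 x_s) *)
Definition demazure (s : S) (p : R) : R := sval (cid (demazure_ex s p)).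

Lemma demazureE s p : (eqnR s *+ 2) * demazure s p = p - act (g s) p.
Proof. by rewrite /demazure; case: cid. Qed.

Lemma eqnR2_neq0 s : eqnR s *+ 2 != 0.
Proof. by rewrite -scaler_nat scaler_eq0 pnatr_eq0 /= eqnR_neq0. Qed.

Lemma demazure_uniq s p q : p - act (g s) p = (eqnR s *+ 2) * q ->
  demazure s p = q.
Proof. by move=> E; apply: (mulfI (eqnR2_neq0 s)); rewrite demazureE. Qed.

Lemma demazureD s p q : demazure s (p + q) = demazure s p + demazure s q.
Proof.
by apply: demazure_uniq; rewrite mulrDr !demazureE actD opprD addrACA.
Qed.

Lemma demazureMl s a p : invariant_under s a ->
  demazure s (a * p) = a * demazure s p.
Proof.
move=> Ha; apply: demazure_uniq.
by rewrite mulrCA demazureE actM Ha mulrBr.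
Qed.

Lemma rdeg_demazure s i p : rdeg i p -> rdeg (i - 2) (demazure s p).
Proof. by move=> /(demazure_rdeg_ex s) [q Hq /demazure_uniq ->]. Qed.

(* The standard bimodule R_x: R with right action p . q = p x(q), and 1 in
   degree - l(x). *)
Section Standard.
Variable x : W.
Let sdeg (i : int) (p : R) := rdeg (i + (cox_length C x)%:Z) p.

Fact std_lact i j p q : rdeg i p -> sdeg j q -> sdeg (i + j) (p * q).
Proof. by rewrite /sdeg -addrA; apply: rdegM. Qed.
Fact std_ract i j p q : sdeg i p -> rdeg j q -> sdeg (i + j) (p * act x q).
Proof. by rewrite /sdeg addrAC => Hp Hq; apply/rdegM/rdeg_act. Qed.

Program Definition standard : bimod :=
  @Bimod _ _ R *%R (fun p q => p * act x q) sdeg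
    (fun p => mulrDr p) (fun p q y => mulrDl p q y)
    (fun p q y => mulrA p q y) (@mul1r _) (fun y z p => mulrDl y z _)
    _ _ _ _ (fun i => or_introl erefl) (fun i => @rdegB _ _ _)
    std_lact std_ract.
Next Obligation. by rewrite actD mulrDr. Qed.
Next Obligation. by rewrite actM mulrA. Qed.
Next Obligation. by rewrite act1 mulr1. Qed.
Next Obligation. by rewrite mulrA. Qed.
End Standard.

(* B_s (x)_R M = (R (x)_(R^s) M)(1), where B_s = (R (x)_(R^s) R)(1) *)
Definition theta (s : S) (M : bimod) : bimod :=
  bshift 1 (tensor (invariant_under s) (regular K n) M).

Definition theta_map s (M M' : bimod) (f : ghom M M') :
    ghom (theta s M) (theta s M') :=
  mkghom (homZ_shift 1 (tmapr_homZ (invariant_under s) (regular K n) (ghomZ f))).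

(* BS(s1 ... sn) = (R (x)_(R^s1) (R (x)_(R^s2) (... (x)_(R^sn) R)))(n), so that
   BS(s) is B_s itself. *)
Fixpoint BS (e : seq S) : bimod :=
  if e is s :: e' then theta s (BS e') else regular K n.

Definition thpure s (M : bimod) (p : R) (b : M) : theta s M :=
  @tpure _ _ (invariant_under s) (regular K n) M p b.

(* 1 (x) ... (x) 1 *)
Fixpoint BS1 (e : seq S) : BS e :=
  if e is s :: e' then thpure s 1 (BS1 e') else (1 : R).

Definition BScast e e' (E : e = e') : ghom (BS e) (BS e') :=
  match E in _ = e0 return ghom (BS e) (BS e0) with erefl => gid (BS e) end.

(* The isomorphism BS(z ++ y) = BS(z) (x)_R BS(y) and its inverse. *)
Fixpoint BSsplit (z y : seq S) : ghom (BS (z ++ y)) (tensorR (BS z) (BS y)) :=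
  if z is s :: z' then
    gcomp (mkghom (homdeg_homZ (assocl_homdeg (invariant_under s) 1
             (regular K n) (BS z') (BS y))))
          (theta_map s (BSsplit z' y))
  else mkghom (homdeg_homZ (lunit_inv_homdeg (BS y))).

Fixpoint BSjoin (z y : seq S) : ghom (tensorR (BS z) (BS y)) (BS (z ++ y)) :=
  if z is s :: z' then
    gcomp (theta_map s (BSjoin z' y))
          (mkghom (homdeg_homZ (assocr_homdeg (invariant_under s) 1
             (regular K n) (BS z') (BS y))))
  else mkghom (homdeg_homZ (lunit_homdeg (BS y))).

Lemma theta_map_pure s (M M' : bimod) (f : ghom M M') p b :
  theta_map s f (thpure s p b) = thpure s p (f b).
Proof. exact/tmapr_pure/homZ_bimor/ghomZ. Qed.

Lemma theta_map_cancel s (M M' : bimod) (f : ghom M M') (f' : ghom M' M) :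
  cancel f f' -> cancel (theta_map s f) (theta_map s f').
Proof.
move=> Hf b; elim/tensor_ind: b => [|b b' Hb Hb'|p b].
- by rewrite !(bimor_0 (homZ_bimor (ghomZ (theta_map _ _)))).
- by rewrite !(bimor_add _ _ (homZ_bimor (ghomZ (theta_map _ _)))) Hb Hb'.
- by rewrite -/(thpure s p b) !theta_map_pure Hf.
Qed.

Lemma BSsplitK z y : cancel (BSsplit z y) (BSjoin z y).
Proof.
elim: z => [|s z IH] b; first exact: lunit_invK.
by rewrite /= assoclK; apply: (theta_map_cancel IH).
Qed.

Lemma BSjoinK z y : cancel (BSjoin z y) (BSsplit z y).
Proof.
elim: z => [|s z IH] b; first exact: lunitK.
rewrite -[RHS]assocrK; congr assocl.
exact: (theta_map_cancel IH).
Qed.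

Fixpoint lwhisk (x : seq S) z z' (f : ghom (BS z) (BS z')) :
    ghom (BS (x ++ z)) (BS (x ++ z')) :=
  if x is s :: x' then theta_map s (lwhisk x' f) else f.

Definition rwhisk z z' (f : ghom (BS z) (BS z')) (y : seq S) :
    ghom (BS (z ++ y)) (BS (z' ++ y)) :=
  gcomp (BSjoin z' y)
    (gcomp (mkghom (tmapl_homZ (fun _ => True) (BS y) (ghomZ f))) (BSsplit z y)).

(* id_BS(x) (x) f (x) id_BS(y) *)
Definition whisk x z z' (f : ghom (BS z) (BS z')) y :
    ghom (BS (x ++ z ++ y)) (BS (x ++ z' ++ y)) := lwhisk x (rwhisk f y).

(* rwhisk f y is f (x) id under BS(z ++ y) = BS(z) (x)_R BS(y) *)
Lemma rwhisk_join z z' (f : ghom (BS z) (BS z')) y (b : BS z) (c : BS y) :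
  rwhisk f y (BSjoin z y (tpureR b c)) = BSjoin z' y (tpureR (f b) c).
Proof.
rewrite /= BSjoinK; congr (BSjoin z' y _).
exact/tmapl_pure/homZ_bimor/ghomZ.
Qed.

(* m_s : p (x) q |-> p q *)
Definition mult_fun (s : S) : BS [:: s] -> BS [::] :=
  tlift (fun p q : regular K n => (p : R) * q : regular K n).

Fact balanced_mult s :
  balanced (invariant_under s) (fun p q : regular K n => (p : R) * q : regular K n).
Proof. by split=> *; rewrite /= ?mulrDl ?mulrDr ?mulrA. Qed.

Lemma mult_pure s (p q : R) : @mult_fun s (thpure s p (q : regular K n)) = p * q.
Proof. by rewrite /mult_fun tliftE //; apply: balanced_mult. Qed.

Lemma mult_homdeg s : homdeg 1 (@mult_fun s).
Proof.
rewrite -[1]add0r; apply: homdeg_shiftl; apply: tlift_homdeg => /=.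
- exact: balanced_mult.
- by move=> p x y; rewrite mulrA.
- by move=> x y p; rewrite mulrA.
- by move=> i j x y Hx Hy; rewrite addr0; apply: rdegM.
Qed.

Definition mult s : ghom (BS [:: s]) (BS [::]) :=
  mkghom (homdeg_homZ (mult_homdeg s)).

(* j_s : p (x) q (x) r |-> p d_s(q) (x) r *)
Definition junction_fun (s : S) : BS [:: s; s] -> BS [:: s] :=
  tlift (fun (p : regular K n) (t : BS [:: s]) =>
    tlift (fun q r : regular K n => thpure s ((p : R) * demazure s q) r) t).

Fact balanced_junction1 s (p : R) : balanced (invariant_under s)
  (fun q r : regular K n => thpure s (p * demazure s q) r).
Proof.
rewrite /thpure; split=> [q q' r|q r r'|q a r Ha] /=.
- by rewrite demazureD mulrDr tpureDl.
- by rewrite tpureDr.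
- rewrite -tpure_bal //; congr tpure.
  by rewrite /= [X in demazure s X]mulrC demazureMl // mulrCA mulrC.
Qed.

Fact balanced_junction s : balanced (invariant_under s)
  (fun (p : regular K n) (t : BS [:: s]) =>
    tlift (fun q r : regular K n => thpure s ((p : R) * demazure s q) r) t).
Proof.
split=> [p p' t|p t t'|p a t Ha].
- rewrite -tlift_addf; apply: tlift_eq => q r.
  by rewrite /thpure mulrDl tpureDl.
- exact/tliftD/balanced_junction1.
- elim/tensor_ind: t => [|t t' Ht Ht'|q r].
  + rewrite (lactr0 (BS [:: s])) !tlift0 //; exact: balanced_junction1.
  + rewrite (@lactDr _ _ (BS [:: s])) !tliftD ?Ht ?Ht' //;
      exact: balanced_junction1.
  + rewrite [lact a _]tlact_pure !tliftE; try exact: balanced_junction1.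
    by rewrite /= demazureMl // mulrA.
Qed.

Lemma junction_pure s (p q r : R) :
  @junction_fun s (thpure s p (thpure s q (r : regular K n))) =
  thpure s (p * demazure s q) (r : regular K n).
Proof.
rewrite /junction_fun tliftE; last exact: balanced_junction.
by rewrite tliftE //; apply: balanced_junction1.
Qed.

Lemma junction_homdeg s : homdeg (-1) (@junction_fun s).
Proof.
rewrite [-1](_ : _ = -2 + 1) //; apply: homdeg_shiftl.
apply: tlift_homdeg; first exact: balanced_junction.
- move=> a p t; elim/tensor_ind: t => [|t t' Ht Ht'|q r].
  + by rewrite !tlift0 ?lactr0 //; apply: balanced_junction1.
  + rewrite !tliftD ?Ht ?Ht' ?lactDr //; exact: balanced_junction1.
  + rewrite !tliftE; try exact: balanced_junction1.
    by rewrite [RHS]tlact_pure /= mulrA.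
- move=> p t a; elim/tensor_ind: t => [|t t' Ht Ht'|q r].
  + rewrite (ractl0 (BS [:: s])) !tlift0 ?ractl0 //; exact: balanced_junction1.
  + rewrite (@ractDl _ _ (BS [:: s])) !tliftD ?Ht ?Ht' ?ractDl //;
      exact: balanced_junction1.
  + rewrite [ract _ a]tract_pure !tliftE; try exact: balanced_junction1.
    by rewrite [RHS]tract_pure.
- move=> i j p t Hp /= Ht.
  rewrite (_ : 1 + (i + j - 2) = i + (1 + j) - 2); last by rewrite addrA addrCA.
  elim: Ht => {j t} [a|a u t _ IHu _ IHt|a b q r Hq Hr].
  + rewrite tlift0; [exact: tdeg0 | exact: balanced_junction1].
  + rewrite tliftB; [exact: tdegB | exact: balanced_junction1].
  + rewrite tliftE; last exact: balanced_junction1.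
    rewrite (_ : i + (a + b) - 2 = i + (a - 2) + b).
      by apply: tdeg_pure Hr; apply/rdegM/rdeg_demazure.
    by rewrite -[RHS]addrA [a - 2 + b]addrAC [RHS]addrA.
Qed.

Definition junction s : ghom (BS [:: s; s]) (BS [:: s]) :=
  mkghom (homdeg_homZ (junction_homdeg s)).

(* p0 (x) p1 (x) ... (x) pk |-> p0 s1(p1 s2(p2 ... sk(pk))) *)
Fixpoint beta_fun (e : seq S) : BS e -> R :=
  match e return BS e -> R with
  | [::] => fun p => p
  | s :: e' => tlift (fun (p : regular K n) (b : BS e') =>
                        (p : R) * act (g s) (beta_fun b))
  end.

Lemma beta_homdeg e : homdeg ((size e)%:Z - (cox_length C (wprod g e))%:Z)
  (@beta_fun e : BS e -> standard (wprod g e)).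
Proof.
elim: e => [|s e [[bD bl br] db]].
  split; first split=> //= p q; first by rewrite act_1.
  by move=> i p Hp /=; rewrite add0r addrNK.
have bal : balanced (invariant_under s) (fun (p : regular K n) (b : BS e) =>
    (p : R) * act (g s) (beta_fun b) : standard (wprod g (s :: e))).
  split=> [p p' b|p b b'|p a b Ha].
  - exact: mulrDl.
  - by rewrite bD [act _ _]actD [LHS]mulrDr.
  - by rewrite bl /= actM Ha mulrA.
rewrite [(size _)%:Z - _](_ : _ = (size e)%:Z -
  (cox_length C (wprod g (s :: e)))%:Z + 1); last by rewrite addrAC /= -addn1 PoszD.
apply: homdeg_shiftl; apply: (tlift_homdeg bal).
- by move=> p q b; rewrite /= mulrA.
- by move=> q b p; rewrite /= br /= actM act_act mulrA.
- move=> i j p b Hp /db; rewrite /= addrA !addrNK => Hb.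
  by rewrite addrA addrNK -addrA; apply/rdegM/rdeg_act.
Qed.

Definition beta e : ghom (BS e) (standard (wprod g e)) :=
  mkghom (homdeg_homZ (beta_homdeg e)).

(* The morphisms f_st, for s <> t with m_st finite; the other values of
   braid_mor are irrelevant. *)
Record braid_morphisms := BraidMorphisms {
  braid_mor : forall s t, ghom (BS (alternating (cox_m C s t) s t))
                               (BS (alternating (cox_m C s t) t s));
  braid_mor_deg : forall s t, s <> t -> (0 < cox_m C s t)%N ->
    homdeg 0 (braid_mor s t);
  braid_mor1 : forall s t, s <> t -> (0 < cox_m C s t)%N ->
    braid_mor s t (BS1 _) = BS1 _
}.

(* The choices entering the construction of the leaves. The braid moves used
   in a descent step may depend on the node of the tree, which is given by the
   root expression e and the path p from the root. *)
Record leaf_choices := LeafChoices {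
  rex : W -> seq S;
  rex_prod : forall x, wprod g (rex x) = x;
  rex_reduced : forall x, reduced C (rex x);
  descent_moves : forall (e : seq S) (p : seq bool) (t : seq S) (s : S),
    reduced C t ->
    (cox_length C (wprod g t * g s)%g < cox_length C (wprod g t))%N ->
    {t' : seq S & braid_seq C t (t' ++ [:: s])};
  final_moves : forall t, reduced C t -> braid_seq C t (rex (wprod g t))
}.

Variables (F : braid_morphisms) (ch : leaf_choices).

Fixpoint braid_seq_mor e e' (b : braid_seq C e e') : ghom (BS e) (BS e') :=
  match b in braid_seq _ e1 e2 return ghom (BS e1) (BS e2) with
  | braid_nil e => gid (BS e)
  | braid_cons x s t y e _ _ b' =>
      gcomp (braid_seq_mor b') (whisk x (braid_mor F s t) y)
  end.

(* BS(t) BS(s r) -> BS(t' s) BS(s r) -> BS(t' s) BS(r) *)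
Definition descent_mor t t' s (b : braid_seq C t (t' ++ [:: s])) r :
    ghom (BS (t ++ s :: r)) (BS (t' ++ s :: r)) :=
  gcomp (whisk t' (junction s) r)
    (gcomp (BScast (esym (catA t' [:: s] (s :: r))))
           (rwhisk (braid_seq_mor b) (s :: r))).

(* node e p t r f: following the path p (false: apply id (x) m_s (x) id, true:
   apply the identity) from the root of the tree of e leads to the node
   BS(t)BS(r), and f is the composite of the edges. *)
Inductive node (e : seq S) :
    seq bool -> forall t r : seq S, ghom (BS e) (BS (t ++ r)) -> Prop :=
| node_root : @node e [::] [::] e (gid (BS e))
| node_up0 p t s r f of @node e p t (s :: r) f &
    (cox_length C (wprod g t) < cox_length C (wprod g t * g s)%g)%N :
    @node e (rcons p false) t r (gcomp (whisk t (mult s) r) f)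
| node_up1 p t s r f of @node e p t (s :: r) f &
    (cox_length C (wprod g t) < cox_length C (wprod g t * g s)%g)%N :
    @node e (rcons p true) (t ++ [:: s]) r
      (gcomp (BScast (catA t [:: s] r)) f)
| node_down0 p t s r f (Ht : reduced C t)
    (Hs : (cox_length C (wprod g t * g s)%g < cox_length C (wprod g t))%N)
    of @node e p t (s :: r) f :
    let m := descent_moves ch e p Ht Hs in
    @node e (rcons p false) (projT1 m) r
      (gcomp (whisk (projT1 m) (mult s) r) (gcomp (descent_mor (projT2 m) r) f))
| node_down1 p t s r f (Ht : reduced C t)
    (Hs : (cox_length C (wprod g t * g s)%g < cox_length C (wprod g t))%N)
    of @node e p t (s :: r) f :
    let m := descent_moves ch e p Ht Hs in
    @node e (rcons p true) (projT1 m ++ [:: s]) r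
      (gcomp (BScast (catA (projT1 m) [:: s] r))
             (gcomp (descent_mor (projT2 m) r) f)).

(* leaf e u l: l belongs to the set of leaves L_e(u) *)
Inductive leaf (e : seq S) : forall u : W, ghom (BS e) (BS (rex ch u)) -> Prop :=
| Leaf p t f (Ht : reduced C t) of @node e p t [::] f :
    @leaf e (wprod g t)
      (gcomp (braid_seq_mor (final_moves ch Ht)) (gcomp (BScast (cats0 t)) f)).

Definition identity_leaf (x : W) : Prop :=
  forall l, @leaf (rex ch x) x l -> l = gid (BS (rex ch x)).

Definition beta_at (x : W) : ghom (BS (rex ch x)) (standard x) :=
  match rex_prod ch x in _ = y return ghom (BS (rex ch x)) (standard y) with
  | erefl => beta (rex ch x)
  end.

(* Hom^Z(BS(e), R_x) (x)_R K, with K = R / R^+ *)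
Definition hom_residue (e : seq S) (x : W) : bimod :=
  tensorR (hombimod (BS e) (standard x)) (residue K n).

Definition hom_class e x (f : ghom (BS e) (standard x)) : hom_residue e x :=
  @tpure _ _ (fun _ => True) (hombimod (BS e) (standard x)) (residue K n)
    f (1 : K).

(* Linearity over K, acting on bimodules through the constants of R. *)
Definition scalar_linear (B B' : bimod) (f : B -> B') : Prop :=
  (forall x y, f (x + y) = f x + f y) /\
  (forall (c : K) x, f (ract x c%:MP) = ract (f x) c%:MP).
End Realization.

Arguments leaf {K V W S C rho} F ch e u l.
Arguments hom_class {K V W S C rho} e x f.

(* Main.v *)
(* Let aug be the constant term of beta, so aug (p0 (x) ... (x) pk) is the product
   of the constant terms of the p_i. Composing with aug gives, for every x, a
   pairing of Hom(BS(w), R_x) (x) K with BS(w). A leaf G of degree l(v) - l(u) uses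
   no junction j_s, so aug o G = aug: the pairing for u precomposed with Phi is
   the pairing for v. It remains to see that the pairing for v is nondegenerate.

   This follows from a statement with coefficients: if h : BS(e) -> R_x takes
   values in an ideal I, then h is a combination of leaves (followed by beta) with
   coefficients in I. For I = R the leaves span; for I = R^+ the pairing is
   nondegenerate. The proof is an induction on e. Given h on BS(e) B_s, write
   {x, x s} = {z, z s} with z < z s and phi (b) = h (b (x) 1 (x) 1). Then
   phi (b x_s) - z(x_s) phi (b) is a morphism BS(e) -> R_{zs}; writing it as a
   combination of leaves and extending those by descent steps yields a combination
   with the same difference. After subtracting it, phi itself is a morphism
   BS(e) -> R_z, and ascent steps finish the induction. *)
From mathcomp Require Import all_boot all_order all_algebra perm.
From mathcomp Require Import ring.
From mathcomp Require Import boolp functions reals.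
From mathcomp.multinomials Require Import mpoly.
Require Import Defs.

Set Implicit Arguments.
Unset Strict Implicit.
Unset Printing Implicit Defensive.

Import GRing.Theory Num.Theory.
Local Open Scope ring_scope.

(** The tree of leaves reads an expression from left to right, so the inductions below append
    letters at the right end. *)
Lemma cats1_ind T (P : seq T -> Prop) :
  P [::] -> (forall e s, P e -> P (e ++ [:: s])) -> forall e, P e.
Proof. by move=> P0 PS; elim/last_ind => // e s He; rewrite -cats1; apply: PS. Qed.

(** * Coxeter groups *)

Section Coxeter.
Variables (W : groupType) (S : Type) (C : coxeter_system W S).
Local Notation g := (gen C).
Local Notation len := (cox_length C).
Local Notation pr := (wprod g).
Implicit Types (e : seq S) (s t : S) (x y : W).

Lemma wprod_cat e e' : pr (e ++ e') = (pr e * pr e')%g.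
Proof. by elim: e => [|s e IH] /=; rewrite ?mul1g // IH mulgA. Qed.

Lemma wprod1 s : pr [:: s] = g s.
Proof. exact: mulg1. Qed.

Lemma cox_length_ex x : exists2 e, size e = len x & pr e = x.
Proof.
by rewrite /cox_length; case: ex_minnP => m /asboolP [e [He Hx]] _; exists e.
Qed.

Lemma cox_length_min e : (len (pr e) <= size e)%N.
Proof.
rewrite /cox_length; case: ex_minnP => m _; apply.
by apply/asboolP; exists e.
Qed.

Lemma cox_lengthM x y : (len (x * y)%g <= len x + len y)%N.
Proof.
have [e <- <-] := cox_length_ex x; have [e' <- <-] := cox_length_ex y.
by rewrite -wprod_cat -size_cat cox_length_min.
Qed.

Lemma cox_length_gen s : (len (g s) <= 1)%N.
Proof. by rewrite -wprod1 (cox_length_min [:: s]). Qed.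

Lemma cox_length1 : len 1%g = 0%N.
Proof. by apply/eqP; rewrite -leqn0; apply: (cox_length_min [::]). Qed.

Lemma mulgenK x s : (x * g s * g s = x)%g.
Proof. by rewrite -mulgA gen_sq mulg1. Qed.

Lemma cox_lengthMgen x s : (len (x * g s)%g <= (len x).+1)%N.
Proof. by rewrite -addn1 (leq_trans (cox_lengthM _ _)) // leq_add2l cox_length_gen. Qed.

(** The sign character. Sending every generator to the transposition of [bool] respects the
    relations, since the product of any two images is already trivial. *)
Lemma cox_length_odd : exists f : W -> bool, forall e, f (pr e) = odd (size e).
Proof.
have [|phi phiM phig] := cox_presentation (c := C) (h := fun=> tperm false true).
  by move=> s t; rewrite tperm2 expg1n.
have phi1 : phi 1%g = 1%g by apply: (@mulgI _ (phi 1%g)); rewrite -phiM !mulg1.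
exists (fun x => odd_perm (phi x)); elim=> [|s e IH] /=; first by rewrite phi1 odd_perm1.
by rewrite phiM odd_permM IH phig odd_tperm.
Qed.

Lemma cox_length_neq x s : len (x * g s)%g != len x.
Proof.
have [f Hf] := cox_length_odd; apply/eqP => E.
have [e He xe] := cox_length_ex x; have [e' He' xe'] := cox_length_ex (x * g s)%g.
have := Hf (rcons e s); rewrite -cats1 wprod_cat xe wprod1 -xe' Hf He' E -He.
by rewrite cats1 size_rcons /=; case: odd.
Qed.

Lemma cox_length_cases x s :
  (len x < len (x * g s)%g)%N \/ (len (x * g s)%g < len x)%N.
Proof. by case: ltngtP (cox_length_neq x s) => // _ _; [left | right]. Qed.

(** If one factor had a shorter word, subadditivity of the length would shorten the whole
    product. *)
Lemma reduced_cat e e' : reduced C (e ++ e') -> reduced C e /\ reduced C e'.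
Proof.
rewrite /reduced size_cat wprod_cat => /eqP E.
have H := cox_lengthM (pr e) (pr e'); rewrite -E in H.
have H1 := cox_length_min e; have H2 := cox_length_min e'.
split; rewrite eqn_leq cox_length_min andbT.
  by rewrite -(leq_add2r (size e')) (leq_trans H) // leq_add2l.
by rewrite -(leq_add2l (size e)) (leq_trans H) // leq_add2r.
Qed.

Lemma reduced_rcons e s : reduced C e -> (len (pr e) < len (pr e * g s)%g)%N ->
  reduced C (e ++ [:: s]).
Proof.
rewrite /reduced wprod_cat wprod1 size_cat addn1 => /eqP -> H.
by rewrite eqn_leq H cox_lengthMgen.
Qed.

(** Stripping the outer letters leaves [g s * (g t * g s) ^+ k * g t], which is
    [(g s * g t) ^+ k.+1]. At [k = cox_m C s t] this is the braid relation. *)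
Lemma wprod_alternating k s t :
  (pr (alternating k s t) * (pr (alternating k t s))^-1 = (g s * g t) ^+ k)%g.
Proof.
elim: k s t => [|k IH] s t /=; first by rewrite mulgV expg0.
rewrite invgM gen_inv mulgA -(mulgA (g s)) IH.
elim: k {IH} => [|k IH]; first by rewrite !expg0 mulg1 expg1.
by rewrite expgSr [RHS]expgSr -IH !mulgA.
Qed.

Lemma wprod_braid s t :
  pr (alternating (cox_m C s t) s t) = pr (alternating (cox_m C s t) t s).
Proof.
rewrite -[LHS]mulg1 -(mulVg (pr (alternating (cox_m C s t) t s))) mulgA.
by rewrite wprod_alternating (cox_mP C s t _).2 ?mul1g.
Qed.

Lemma size_alternating k s t : size (alternating k s t) = k.
Proof. by elim: k s t => //= k IH s t; rewrite IH. Qed.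

Lemma braid_seq_wprod e e' (b : braid_seq C e e') : pr e' = pr e.
Proof.
elim: b => // x s t y e1 _ _ _ ->.
by rewrite !wprod_cat wprod_braid.
Qed.

Lemma braid_seq_size e e' (b : braid_seq C e e') : size e' = size e.
Proof.
elim: b => // x s t y e1 _ _ _ ->.
by rewrite !size_cat !size_alternating.
Qed.

Lemma braid_seq_reduced e e' : braid_seq C e e' -> reduced C e -> reduced C e'.
Proof.
by move=> b; rewrite /reduced (braid_seq_wprod b) (braid_seq_size b).
Qed.
End Coxeter.

(** * Demazure operators *)

Section Action.
Variables (K : realType) (V : vectType K) (W : groupType) (S : Type).
Variables (C : coxeter_system W S) (rho : reflection_faithful V C).
Local Notation n := (\dim {:V}).
Local Notation R := {mpoly K[n]}.
Local Notation g := (gen C).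
Local Notation basis := (vbasis {:V}).
Local Notation act := (act rho).
Local Notation eqnR := (eqnR rho).
Local Notation demazure := (demazure rho).
Local Notation inv := (invariant_under rho).
Implicit Types (s : S) (x : W) (p q : R).

Lemma mcoeff_linform (l : V -> K) i : (linform l)@_U_(i) = l basis`_i.
Proof.
rewrite /linform raddf_sum /= (bigD1 i) //= big1 ?addr0 => [|j Hj].
  by rewrite mcoeffZ mcoeffXU eqxx mulr1.
by rewrite mcoeffZ mcoeffXU (negPf Hj) mulr0.
Qed.

(** The linear coefficients of the images of the coordinate functions are the matrix entries of
    [rep rho x^-1], and [rep] is injective. *)
Lemma act_faithful x : (forall p, act x p = p) -> x = 1%g.
Proof.
move=> H; apply: invg_inj; apply: (rep_inj (r := rho)); apply/lfunP => v.
rewrite (coord_vbasis (memvf v)) !linear_sum; apply: eq_bigr => j _.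
rewrite !linearZ; congr (_ *: _).
rewrite [LHS](coord_vbasis (memvf _)) [RHS](coord_vbasis (memvf _)).
apply: eq_bigr => i _; congr (_ *: _).
have /(congr1 (fun p => p@_U_(j))) : act x 'X_i = act 1%g 'X_i by rewrite H act_1.
by rewrite !actX !mcoeff_linform.
Qed.

(** The vector v + s(v) is fixed by s, hence killed by x_s. *)
Lemma act_eqnR s : act (g s) (eqnR s) = - eqnR s.
Proof.
rewrite /Defs.eqnR act_linform /linform -sumrN; apply: eq_bigr => i _.
rewrite -scaleNr; congr (_ *: _); set v := basis`_i.
have : v + rep rho (g s) v \in lker (eqn rho s).
  rewrite eqn_ker; apply/fixedSpaceP.
  have := congr1 (fun f : 'End(V) => f v) (repM rho (g s) (g s)).
  by rewrite gen_sq rep1 !lfunE /= => E; rewrite linearD /= -E addrC.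
by rewrite memv_ker linearD gen_inv /= addr_eq0 => /eqP ->; rewrite opprK.
Qed.

Lemma act_gen_inv s p : act (g s) (act (g s) p) = p.
Proof. by rewrite act_act gen_sq act_1. Qed.

(** Applying s changes the sign of p - s(p) and of x_s, so it fixes their quotient. *)
Lemma demazure_inv s p : inv s (demazure s p).
Proof.
apply: esym; apply: demazure_uniq.
have /(congr1 (act (g s))) := demazureE rho s p.
rewrite actM actB act_gen_inv mulr2n actD act_eqnR => E.
by apply: oppr_inj; rewrite opprB -mulNr opprD E.
Qed.

Lemma act_gen_demazure s p : act (g s) p = p - eqnR s *+ 2 * demazure s p.
Proof. by rewrite demazureE subKr. Qed.

(** With [demazure_inv] this gives R = R^s + x_s R^s. *)
Lemma inv_demazure_rest s p : inv s (p - eqnR s * demazure s p).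
Proof.
rewrite /invariant_under actB actM act_eqnR demazure_inv act_gen_demazure; ring.
Qed.

Lemma inv_eqnR_sq s : inv s (eqnR s * eqnR s).
Proof. by rewrite /invariant_under actM act_eqnR mulrNN. Qed.

Lemma demazure_eqnR s : demazure s (eqnR s) = 1.
Proof. by apply: demazure_uniq; rewrite act_eqnR opprK mulr1 mulr2n. Qed.

(** The polynomial identity behind [peel_diff_junction]: moving x_s out of the Demazure operator
    leaves the action of s. *)
Lemma demazureMeqn s q :
  demazure s (q * eqnR s) - eqnR s * demazure s q = act (g s) q.
Proof.
have -> : demazure s (q * eqnR s) = q - eqnR s * demazure s q.
  by apply: demazure_uniq; rewrite actM act_eqnR act_gen_demazure; ring.
by rewrite act_gen_demazure; ring.
Qed.

(** The action substitutes linear forms for the variables. Hence the twist in the right action on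
    R_x disappears modulo R^+. *)
Lemma mcoeff0_act x p : (act x p)@_0%MM = p@_0%MM.
Proof.
elim/mpoly_hom_ind: p => [|p q Hp Hq|i p].
- by rewrite act0.
- by rewrite actD !mcoeffD Hp Hq.
move: i p; apply: rdeg_ind => [i|i p q Hp Hq|i c p Hp||i j p q Hp Hq|i].
- by rewrite act0.
- by rewrite actD !mcoeffD Hp Hq.
- by rewrite actZ !mcoeffZ Hp.
- by rewrite act1.
- by rewrite actM !mcoeff0M Hp Hq.
have H2 q : rdeg 2 q -> q@_0%MM = 0 by case/mcoeff0_rdeg.
by rewrite !H2 //; [exact: rdegX | apply/rdeg_act/rdegX].
Qed.
End Action.

(** * Bott-Samelson bimodules of concatenated expressions *)

Section Ghom.
Variables (K : fieldType) (n : nat) (B B' : bimod K n) (f : ghom B B').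
Implicit Types (x y : B) (p : {mpoly K[n]}).

Lemma ghom_bimor : bimor f.
Proof. exact/homZ_bimor/ghomZ. Qed.

Lemma ghomD x y : f (x + y) = f x + f y.
Proof. exact/bimor_add/ghom_bimor. Qed.

Lemma ghom0 : f 0 = 0.
Proof. exact/bimor_0/ghom_bimor. Qed.

Lemma ghom_lact p x : f (lact p x) = lact p (f x).
Proof. by case: ghom_bimor => _ ->. Qed.

Lemma ghom_ract p x : f (ract x p) = ract (f x) p.
Proof. by case: ghom_bimor => _ _ ->. Qed.
End Ghom.

Section Concatenation.
Variables (K : realType) (V : vectType K) (W : groupType) (S : Type).
Variables (C : coxeter_system W S) (rho : reflection_faithful V C).
Local Notation n := (\dim {:V}).
Local Notation R := {mpoly K[n]}.
Local Notation g := (gen C).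
Local Notation pr := (wprod g).
Local Notation act := (act rho).
Local Notation BS := (BS rho).
Local Notation BS1 := (BS1 rho).
Local Notation BScast := (BScast rho).
Implicit Types (s : S) (p q : R) (x y z : seq S).

(** The pure tensor of BS(z) and BS(y), read in BS(z ++ y). Such elements generate by [otimes_ind],
    so morphisms are compared on them. *)
Definition otimes z y (b : BS z) (c : BS y) : BS (z ++ y) :=
  BSjoin rho z y (tpureR b c).

Section Otimes.
Variables z y : seq S.
Implicit Types (b : BS z) (c : BS y).

Lemma otimesDl b b' c : otimes (b + b') c = otimes b c + otimes b' c.
Proof. by rewrite /otimes tpureDl ghomD. Qed.

Lemma otimesDr b c c' : otimes b (c + c') = otimes b c + otimes b c'.
Proof. by rewrite /otimes tpureDr ghomD. Qed.

Lemma otimes0l c : otimes (0 : BS z) c = 0.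
Proof. by rewrite /otimes tpure0l ghom0. Qed.

Lemma otimes0r b : otimes b (0 : BS y) = 0.
Proof. by rewrite /otimes tpure0r ghom0. Qed.

Lemma otimes_lact p b c : otimes (lact p b) c = lact p (otimes b c).
Proof. by rewrite /otimes -ghom_lact /= tlact_pure. Qed.

Lemma otimes_ract b c p : otimes b (ract c p) = ract (otimes b c) p.
Proof. by rewrite /otimes -ghom_ract /= tract_pure. Qed.

Lemma otimes_bal b p c : otimes (ract b p) c = otimes b (lact p c).
Proof. by rewrite /otimes tpure_bal. Qed.

Lemma otimes_ind (P : BS (z ++ y) -> Prop) :
  P 0 -> (forall u v, P u -> P v -> P (u + v)) -> (forall b c, P (otimes b c)) ->
  forall u, P u.
Proof.
move=> P0 PD Pb u; rewrite -(BSsplitK u).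
elim/tensor_ind: (BSsplit _ _ _ _) => [|t t' Ht Ht'|b c]; first by rewrite ghom0.
  by rewrite ghomD; apply: PD.
exact: Pb.
Qed.

Lemma rwhisk_otimes z' (f : ghom (BS z) (BS z')) b c :
  rwhisk f y (otimes b c) = otimes (f b) c.
Proof. exact: rwhisk_join. Qed.
End Otimes.

Lemma BS_ind s e (P : BS (s :: e) -> Prop) :
  P 0 -> (forall u v, P u -> P v -> P (u + v)) -> (forall p b, P (thpure rho s p b)) ->
  forall u, P u.
Proof. by move=> P0 PD Pb; elim/tensor_ind. Qed.

Lemma otimes_nil y p (c : BS y) : @otimes [::] y p c = lact p c.
Proof. by rewrite /otimes /= /lunit tliftE //; apply: balanced_lunit. Qed.

Lemma otimes_cons s z y p (b : BS z) (c : BS y) :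
  @otimes (s :: z) y (thpure rho s p b) c = thpure rho s p (otimes b c).
Proof.
have E := @assocr_pure K n (invariant_under rho s) 1 (regular K n) (BS z) (BS y) p b c.
transitivity (theta_map rho s (BSjoin rho z y) 
  (@thpure _ _ _ _ _ rho s (tensorR (BS z) (BS y)) p (tpureR b c))); last first.
  exact: theta_map_pure.
exact: (congr1 (theta_map rho s (BSjoin rho z y)) E).
Qed.

Lemma thpure_ract s e q p (b : BS e) :
  ract (thpure rho s p b) q = thpure rho s p (ract b q).
Proof. exact: tract_pure. Qed.

Lemma BScast_thpure s e e' (E : s :: e = s :: e') (E' : e = e') p (b : BS e) :
  BScast E (thpure rho s p b) = thpure rho s p (BScast E' b).
Proof. by case: _ / E' E => E; rewrite (Prop_irrelevance E erefl). Qed.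

(** Equality proofs are irrelevant, so a cast depends on its endpoints only. *)
Lemma BScast_id e (E : e = e) (b : BS e) : BScast E b = b.
Proof. by rewrite (Prop_irrelevance E erefl). Qed.

Lemma BScast_comp e1 e2 e3 (E : e1 = e2) (E' : e2 = e3) (E'' : e1 = e3) (b : BS e1) :
  BScast E' (BScast E b) = BScast E'' b.
Proof. by case: _ / E' E'' => E''; rewrite BScast_id (Prop_irrelevance E E''). Qed.

Lemma otimes_assoc x y z (E : x ++ (y ++ z) = (x ++ y) ++ z) (b : BS x) (c : BS y) (d : BS z) :
  BScast E (otimes b (otimes c d)) = otimes (otimes b c) d.
Proof.
elim: x E b => [|s x IH] E b.
  by rewrite BScast_id !otimes_nil otimes_lact.
elim/BS_ind: b => [|b b' Hb Hb'|p b]; first by rewrite !otimes0l ghom0.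
  by rewrite !otimesDl ghomD Hb Hb'.
by rewrite !otimes_cons (BScast_thpure _ (catA x y z)) IH.
Qed.

Lemma otimes_nilr z (E : z ++ [::] = z) (b : BS z) p :
  BScast E (@otimes z [::] b p) = ract b p.
Proof.
elim: z E b => [|s z IH] E b; first by rewrite BScast_id otimes_nil.
elim/BS_ind: b => [|b b' Hb Hb'|q b].
- by rewrite otimes0l ghom0 ractl0.
- by rewrite otimesDl ghomD Hb Hb' ractDl.
- by rewrite otimes_cons (BScast_thpure _ (cats0 z)) IH thpure_ract.
Qed.

Lemma lwhisk_otimes x z z' (f : ghom (BS z) (BS z')) (b : BS x) (c : BS z) :
  lwhisk x f (otimes b c) = otimes b (f c).
Proof.
elim: x b => [|s x IH] b; first by rewrite !otimes_nil /= ghom_lact.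
elim/BS_ind: b => [|b b' Hb Hb'|q b].
- by rewrite !otimes0l ghom0.
- by rewrite !otimesDl ghomD Hb Hb'.
- by rewrite !otimes_cons -IH; apply: theta_map_pure.
Qed.

Lemma BS1_cat z y : otimes (BS1 z) (BS1 y) = BS1 (z ++ y).
Proof. by elim: z => [|s z IH]; rewrite ?otimes_nil ?lact1 //= otimes_cons IH. Qed.

Local Notation beta := (@beta_fun _ _ _ _ _ rho _).

Lemma beta_bimor e : bimor (@beta_fun _ _ _ _ _ rho e : BS e -> standard rho (pr e)).
Proof. by case: (beta_homdeg rho e). Qed.

Lemma betaD e (b c : BS e) : beta (b + c) = beta b + beta c.
Proof. exact: bimor_add (beta_bimor e). Qed.

Lemma beta0 e : beta (0 : BS e) = 0.
Proof. exact: bimor_0 (beta_bimor e). Qed.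

Lemma beta_lact e p (b : BS e) : beta (lact p b) = p * beta b.
Proof. by case: (beta_bimor e) => _ ->. Qed.

Lemma beta_ract e p (b : BS e) : beta (ract b p) = beta b * act (pr e) p.
Proof. by case: (beta_bimor e) => _ _ ->. Qed.

Lemma beta_thpure s e p (b : BS e) :
  @beta_fun _ _ _ _ _ rho (s :: e) (thpure rho s p b) = p * act (g s) (beta b).
Proof.
rewrite /= tliftE //; split=> [q q' c|q c c'|q a c Ha].
- exact: mulrDl.
- by rewrite betaD actD mulrDr.
- by rewrite beta_lact actM Ha mulrA.
Qed.

Lemma beta_otimes z y (b : BS z) (c : BS y) : beta (otimes b c) = beta b * act (pr z) (beta c).
Proof.
elim: z b => [|s z IH] b; first by rewrite otimes_nil beta_lact /= act_1.
elim/BS_ind: b => [|b b' Hb Hb'|q b].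
- by rewrite otimes0l !beta0 mul0r.
- by rewrite otimesDl !betaD Hb Hb' mulrDl.
- by rewrite otimes_cons [LHS]beta_thpure beta_thpure IH actM act_act mulrA.
Qed.

Lemma beta_cast e e' (E : e = e') (b : BS e) : beta (BScast E b) = beta b.
Proof. by case: _ / E. Qed.

Lemma beta_BS1 e : beta (BS1 e) = 1.
Proof.
elim: e => [//|s e IH].
by apply: etrans (beta_thpure _ _ _) _; rewrite IH act1 mulr1.
Qed.

Lemma theta_map_homdeg s (M M' : bimod K n) (f : ghom M M') k :
  homdeg k f -> homdeg k (theta_map rho s f).
Proof. by move=> Hf; apply/homdeg_shift/tmapr_homdeg. Qed.

Lemma BSjoin_homdeg z y : homdeg 0 (BSjoin rho z y).
Proof.
elim: z => [|s z IH]; first exact: lunit_homdeg.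
rewrite -[0]addr0; apply: homdeg_comp; last exact: assocr_homdeg.
exact: theta_map_homdeg.
Qed.

Lemma otimes_deg z y (b : BS z) (c : BS y) i j :
  bdeg i b -> bdeg j c -> bdeg (i + j) (otimes b c).
Proof.
move=> Hb Hc; rewrite -[i + j]addr0; apply: (BSjoin_homdeg z y).2.
exact: (@tdeg_pure _ _ _ (BS z) (BS y)).
Qed.

Lemma BS1_deg1 s : bdeg (-1) (BS1 [:: s]).
Proof.
exact: (@tdeg_pure _ _ (invariant_under rho s) (regular K n) (regular K n) 0 0
  1 1 (rdeg1 V) (rdeg1 V)).
Qed.

(** The degree is read off in R_x: [beta_fun] is homogeneous and sends this element to 1, whose
    constant term is nonzero. *)
Lemma BS1_deg_uniq e i : bdeg i (BS1 e) -> i = - (size e)%:Z.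
Proof.
move=> /((beta_homdeg rho e).2) /=; rewrite beta_BS1 addrA subrK.
move=> /mcoeff0_rdeg [/eqP|/eqP]; first by rewrite addr_eq0 => /eqP.
by rewrite mcoeff1 eqxx oner_eq0.
Qed.
End Concatenation.

(** * Morphisms to standard bimodules *)

Section Peeling.
Variables (K : realType) (V : vectType K) (W : groupType) (S : Type).
Variables (C : coxeter_system W S) (rho : reflection_faithful V C).
Local Notation n := (\dim {:V}).
Local Notation R := {mpoly K[n]}.
Local Notation g := (gen C).
Local Notation len := (cox_length C).
Local Notation pr := (wprod g).
Local Notation act := (act rho).
Local Notation eqnR := (eqnR rho).
Local Notation demazure := (demazure rho).
Local Notation inv := (invariant_under rho).
Local Notation BS := (BS rho).
Local Notation BS1 := (BS1 rho).
Local Notation beta := (@beta_fun _ _ _ _ _ rho _).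
Implicit Types (s t : S) (p q : R) (e : seq S) (x y z : W).

(** Morphisms to R_x as plain functions to R, without a degree; x enters through the right action
    alone. *)
Definition hom_std e x (h : BS e -> R) : Prop := bimor (h : BS e -> standard rho x).

Section HomStd.
Variables (e : seq S) (x : W) (h : BS e -> R).
Hypothesis Hh : hom_std x h.

Lemma hom_stdD b c : h (b + c) = h b + h c.
Proof. by case: Hh => ->. Qed.

Lemma hom_std0 : h 0 = 0.
Proof. exact: bimor_0 Hh. Qed.

Lemma hom_std_lact p b : h (lact p b) = p * h b.
Proof. by case: Hh => _ ->. Qed.

Lemma hom_std_ract p b : h (ract b p) = h b * act x p.
Proof. by case: Hh => _ _ ->. Qed.
End HomStd.

Lemma hom_std_beta e : hom_std (pr e) (@beta_fun _ _ _ _ _ rho e).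
Proof. exact: beta_bimor. Qed.

Lemma hom_std_add e x (h h' : BS e -> R) :
  hom_std x h -> hom_std x h' -> hom_std x (fun b => h b + h' b).
Proof. exact: bimorD. Qed.

Lemma hom_std_scale e x (h : BS e -> R) p :
  hom_std x h -> hom_std x (fun b => p * h b).
Proof.
move=> [hD hl hr]; split=> [b c|q b|b q]; first by rewrite hD /= mulrDr.
  by rewrite hl /= mulrCA.
by rewrite hr /= mulrA.
Qed.

Lemma hom_std_comp e e' x (h : BS e' -> R) (f : ghom (BS e) (BS e')) :
  hom_std x h -> hom_std x (fun b => h (f b)).
Proof.
move=> [hD hl hr]; split=> [b c|q b|b q]; first by rewrite ghomD hD.
  by rewrite ghom_lact hl.
by rewrite ghom_ract hr.
Qed.

Lemma act_inv x s p : inv s p -> act (x * g s)%g p = act x p.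
Proof. by move=> Hp; rewrite -act_act Hp. Qed.

Lemma act_eqnR_rcons x s : act (x * g s)%g (eqnR s) = - act x (eqnR s).
Proof. by rewrite -act_act act_eqnR -[in LHS]sub0r actB act0 sub0r. Qed.

(** Every p is a + x_s c with a and c invariant under s, so right linearity is a condition on R^s
    and on x_s. *)
Lemma hom_std_gen e s x (h : BS e -> R) :
  (forall b c, h (b + c) = h b + h c) -> (forall p b, h (lact p b) = p * h b) ->
  (forall b p, inv s p -> h (ract b p) = h b * act x p) ->
  (forall b, h (ract b (eqnR s)) = h b * act x (eqnR s)) -> hom_std x h.
Proof.
move=> hD hl hi hx; split=> // b p.
rewrite -[p](subrK (eqnR s * demazure s p)) ractDr hD /= actD mulrDr.
rewrite hi; last exact: inv_demazure_rest.
by rewrite -ractA (hi _ _ (demazure_inv _ _ _)) hx actM mulrA.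
Qed.

Definition otimes1 s e (b : BS e) : BS (e ++ [:: s]) := otimes b (BS1 [:: s]).

Lemma thpure_BS1 s p q :
  thpure rho s p (q : regular K n) = ract (lact p (BS1 [:: s])) q.
Proof.
rewrite [lact p _]tlact_pure [ract _ q]tract_pure.
by congr tpure; rewrite /= ?mulr1 ?mul1r.
Qed.

Lemma otimes_thpure e s (b : BS e) p q :
  @otimes _ _ _ _ _ rho e [:: s] b (thpure rho s p (q : regular K n)) =
  ract (otimes1 s (ract b p)) q.
Proof. by rewrite thpure_BS1 /otimes1 otimes_bal otimes_ract. Qed.

(** In b (x) p (x) q the factor p moves into b and q is a right action, so the elements b (x) 1 (x)
    1 generate BS(e) B_s as a right R-module. *)
Lemma otimes1_ind e s (P : BS (e ++ [:: s]) -> Prop) :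
  P 0 -> (forall u v, P u -> P v -> P (u + v)) ->
  (forall b q, P (ract (otimes1 s b) q)) -> forall u, P u.
Proof.
move=> P0 PD Pb; elim/otimes_ind => // b c.
elim/BS_ind: c => [|c c' Hc Hc'|p q]; first by rewrite otimes0r.
  by rewrite otimesDr; apply: PD.
by rewrite otimes_thpure.
Qed.

Lemma BS1_ract s p : inv s p -> ract (BS1 [:: s]) p = lact p (BS1 [:: s]).
Proof.
move=> Hp; rewrite [ract _ p]tract_pure [lact p _]tlact_pure.
have := @tpure_bal _ _ (inv s) (regular K n) (regular K n) 1 p 1 Hp.
by rewrite /= !mul1r !mulr1.
Qed.

Lemma otimes1_inv e s (b : BS e) p : inv s p ->
  ract (otimes1 s b) p = otimes1 s (ract b p).
Proof. by move=> Hp; rewrite /otimes1 -otimes_ract otimes_bal BS1_ract. Qed.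

Lemma hom_std_eq1 e s x (h h' : BS (e ++ [:: s]) -> R) :
  hom_std x h -> hom_std x h' -> (forall b, h (otimes1 s b) = h' (otimes1 s b)) ->
  forall u, h u = h' u.
Proof.
move=> Hh Hh' E; elim/otimes1_ind => [|u v Hu Hv|b q].
- by rewrite (hom_std0 Hh) (hom_std0 Hh').
- by rewrite (hom_stdD Hh) (hom_stdD Hh') Hu Hv.
- by rewrite (hom_std_ract Hh) (hom_std_ract Hh') E.
Qed.

(** * Removing the last letter of an expression *)

Section Peel.
Variables (e : seq S) (s : S) (x z : W) (h : BS (e ++ [:: s]) -> R).
Hypotheses (Hh : hom_std x h) (Hx : x = z \/ x = (z * g s)%g).

Definition peel (b : BS e) : R := h (otimes1 s b).
(** The failure of [peel] to be a morphism to R_z, measured at x_s. *)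
Definition peel_diff (b : BS e) : R :=
  peel (ract b (eqnR s)) - act z (eqnR s) * peel b.

Lemma peelD b c : peel (b + c) = peel b + peel c.
Proof. by rewrite /peel /otimes1 otimesDl (hom_stdD Hh). Qed.

Lemma peel_lact p b : peel (lact p b) = p * peel b.
Proof. by rewrite /peel /otimes1 otimes_lact (hom_std_lact Hh). Qed.

Lemma peel_inv b p : inv s p -> peel (ract b p) = peel b * act z p.
Proof.
move=> Hp; rewrite /peel -otimes1_inv // (hom_std_ract Hh).
by congr (_ * _); case: Hx => ->; [|exact: act_inv].
Qed.

(* [peel h] is right linear over the s-invariants only, and those act in the same
   way on R_z and R_{zs}; the difference isolates the R_{zs}-part, on which x_s
   acts by the opposite sign. *)
Lemma hom_std_peel_diff : hom_std (z * g s)%g peel_diff.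
Proof.
apply: (@hom_std_gen _ s) => [b c|p b|b p Hp|b]; rewrite /peel_diff.
- by rewrite ractDl !peelD mulrDr opprD addrACA.
- by rewrite lractA !peel_lact mulrBr mulrCA.
- by rewrite act_inv // ractA (mulrC p) -ractA !(peel_inv _ Hp) mulrBl mulrA.
(* As x_s^2 is invariant, [peel] at b x_s^2 is z(x_s)^2 times [peel] at b; so the difference at b
   x_s is -z(x_s) times the difference at b. *)
- rewrite ractA peel_inv; last exact: inv_eqnR_sq.
  by rewrite act_eqnR_rcons actM; ring.
Qed.

Lemma hom_std_peel : (forall b, peel_diff b = 0) -> hom_std z peel.
Proof.
move=> H0; apply: (@hom_std_gen _ s); [exact: peelD|exact: peel_lact|exact: peel_inv|].
by move=> b; rewrite mulrC; apply/eqP; rewrite -subr_eq0; apply/eqP/H0.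
Qed.
End Peel.

Lemma hom_std_nil x (h : BS [::] -> R) (b : BS [::]) : hom_std x h -> h b = b * h (1 : R).
Proof. by move=> Hh; rewrite -(hom_std_lact Hh) /= mulr1. Qed.

(** Both actions on BS of the empty expression are multiplication in the domain R, so h(1) <> 0
    would force x to act trivially. *)
Lemma hom_std_nil_neq1 x (h : BS [::] -> R) : hom_std x h -> x <> 1%g -> forall b, h b = 0.
Proof.
move=> Hh Hx b; rewrite (hom_std_nil b Hh).
have [-> |/eqP h1] := pselect (h (1 : R) = 0); first by rewrite mulr0.
case: Hx; apply: (act_faithful (rho := rho)) => p; apply: (mulfI h1).
by rewrite -(hom_std_ract Hh) /= mul1r (hom_std_nil p Hh) mulrC.
Qed.

(** Peeling a letter gives morphisms to R_{xs} and then R_x. The lengths of both xs and x exceed the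
    size of the shortened expression. *)
Lemma hom_std_long e x (h : BS e -> R) :
  hom_std x h -> (size e < len x)%N -> forall b, h b = 0.
Proof.
elim/cats1_ind: e x h => [|e s IH] x h.
  by move=> Hh Hx; apply: (hom_std_nil_neq1 Hh) => x1; rewrite x1 cox_length1 in Hx.
move=> Hh; rewrite size_cat addn1 => Hx.
apply: (hom_std_eq1 Hh (bimor0 _ _)) => b.
have Hd := hom_std_peel_diff Hh (or_introl erefl).
apply: (IH x _ (hom_std_peel Hh (or_introl erefl) _)) => [c|]; last exact: ltnW.
apply: (IH _ _ Hd).
by have := cox_lengthMgen C (x * g s)%g s; rewrite mulgenK => /(leq_trans Hx).
Qed.

(* [Hom (BS e, R_x)] has rank one for e reduced, which identifies beta after a
   braid move. *)
Lemma hom_std_reduced e (h : BS e -> R) : reduced C e -> hom_std (pr e) h ->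
  forall b, h b = h (BS1 e) * beta b.
Proof.
elim/cats1_ind: e h => [|e s IH] h.
  by move=> _ Hh b; rewrite (hom_std_nil b Hh) mulrC.
move=> He Hh; have [He1 _] := reduced_cat He.
have Ex : pr (e ++ [:: s]) = (pr e * g s)%g by rewrite wprod_cat wprod1.
rewrite {}Ex in Hh.
have Hd := hom_std_peel_diff Hh (or_intror erefl).
have Hp : hom_std (pr e) (peel h).
  (* Here z is [pr e]; the difference maps to R_{zs} with zs longer than e, so it vanishes. *)
  apply: (hom_std_peel Hh (or_intror erefl)); apply: (hom_std_long Hd).
  by move: He; rewrite /reduced size_cat addn1 wprod_cat wprod1 => /eqP <-.
have Hb := hom_std_beta (e ++ [:: s]); rewrite wprod_cat wprod1 in Hb.
apply: (hom_std_eq1 Hh (hom_std_scale _ Hb)) => b.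
rewrite -[LHS]/(peel h b) (IH _ He1 Hp) -BS1_cat; congr (_ * _).
by rewrite beta_otimes beta_BS1 act1 mulr1.
Qed.

Lemma beta_whisk e e1 e2 e' (f : ghom (BS e1) (BS e2)) :
  pr e1 = pr e2 -> (forall b : BS e1, beta (f b) = beta b) ->
  forall b, beta (whisk e f e' b) = beta b.
Proof.
move=> Ep Hf; elim/otimes_ind => [|b c Hb Hc|b c]; first by rewrite ghom0 !beta0.
  by rewrite ghomD !betaD Hb Hc.
rewrite /whisk lwhisk_otimes !beta_otimes; congr (_ * act _ _).
elim/otimes_ind: c => [|c c' Hc Hc'|c d]; first by rewrite ghom0 !beta0.
  by rewrite ghomD !betaD Hc Hc'.
by rewrite rwhisk_otimes !beta_otimes Hf Ep.
Qed.

(** The alternating factor of a reduced expression is reduced. There beta after f_st is a multiple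
    of beta, and the factor is 1 because f_st preserves 1 (x) ... (x) 1. *)
Lemma beta_braid_seq (F : braid_morphisms rho) e e' (B : braid_seq C e e') :
  reduced C e -> forall b, beta (braid_seq_mor F B b) = beta b.
Proof.
elim: B => // a s t c e1 Hst Hm B IH He b.
rewrite [LHS]IH; last first.
  by move: He; rewrite /reduced !wprod_cat wprod_braid !size_cat !size_alternating.
apply: beta_whisk b => [|b]; first exact: wprod_braid.
have [_ /reduced_cat [Hr _]] := reduced_cat He.
have Hh := hom_std_beta (alternating (cox_m C s t) t s).
rewrite -wprod_braid in Hh.
rewrite (hom_std_reduced Hr (hom_std_comp (braid_mor F s t) Hh)) braid_mor1 //.
by rewrite beta_BS1 mul1r.
Qed.
End Peeling.

(** * Restricting nodes of the tree to prefixes *)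

Section Nodes.
Variables (K : realType) (V : vectType K) (W : groupType) (S : Type).
Variables (C : coxeter_system W S) (rho : reflection_faithful V C).
Variables (F : braid_morphisms rho) (ch : leaf_choices C).
Local Notation n := (\dim {:V}).
Local Notation R := {mpoly K[n]}.
Local Notation g := (gen C).
Local Notation len := (cox_length C).
Local Notation pr := (wprod g).
Local Notation act := (act rho).
Local Notation eqnR := (eqnR rho).
Local Notation demazure := (demazure rho).
Local Notation BS := (BS rho).
Local Notation BS1 := (BS1 rho).
Local Notation BScast := (BScast rho).
Local Notation beta := (@beta_fun _ _ _ _ _ rho _).
Implicit Types (s : S) (p q : R) (e t r E : seq S).

Definition mult_last t s : ghom (BS (t ++ [:: s])) (BS t) :=
  gcomp (BScast (cats0 t)) (lwhisk t (mult rho s)).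

Lemma mult_last_otimes t s (b : BS t) (d : BS [:: s]) :
  mult_last t s (otimes b d) = ract b (mult rho s d : R).
Proof. by rewrite /= lwhisk_otimes otimes_nilr. Qed.

Definition junction_last t s : ghom (BS ((t ++ [:: s]) ++ [:: s])) (BS (t ++ [:: s])) :=
  gcomp (lwhisk t (junction rho s)) (BScast (esym (catA t [:: s] [:: s]))).

Lemma BScast_esym_otimes x y z (b : BS x) (c : BS y) (d : BS z) :
  BScast (esym (catA x y z)) (otimes (otimes b c) d) = otimes b (otimes c d).
Proof. by rewrite -(otimes_assoc (catA x y z)) (BScast_comp _ _ erefl). Qed.

Lemma junction_last_otimes t s (b : BS t) (c d : BS [:: s]) :
  junction_last t s (otimes (otimes b c) d) = otimes b (junction rho s (otimes c d)).
Proof. by rewrite /= BScast_esym_otimes lwhisk_otimes. Qed.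

Lemma junction_otimes s p q :
  junction rho s (@otimes _ _ _ _ _ rho [:: s] [:: s]
    (thpure rho s p (q : regular K n)) (BS1 [:: s])) =
  thpure rho s (p * demazure s q) (1 : regular K n).
Proof.
rewrite otimes_cons (@otimes_nil _ _ _ _ _ rho [:: s]).
rewrite [lact q _]tlact_pure /= mulr1; exact: junction_pure.
Qed.

Lemma mult_thpure s p q : mult rho s (thpure rho s p (q : regular K n)) = p * q.
Proof. exact: mult_pure. Qed.

Lemma mult_last_otimes1 t s (b : BS t) : mult_last t s (otimes1 s b) = b.
Proof. by rewrite mult_last_otimes mult_thpure mulr1 ract1. Qed.

Lemma beta_otimes1 t s (b : BS t) : beta (otimes1 s b) = beta b.
Proof. by rewrite beta_otimes beta_BS1 act1 mulr1. Qed.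

Lemma beta_otimes1_ract t s (b : BS t) q :
  beta (ract (otimes1 s b) q) = beta b * act (pr t) (act (g s) q).
Proof. by rewrite beta_ract beta_otimes1 wprod_cat wprod1 act_act. Qed.

Lemma junction_last_otimes1 t s (b : BS t) q :
  junction_last t s (otimes1 s (ract (otimes1 s b) q)) = otimes1 s (ract b (demazure s q)).
Proof.
rewrite /otimes1 -otimes_ract junction_last_otimes.
have -> : ract (BS1 [:: s]) q = thpure rho s 1 (q : regular K n).
  by rewrite thpure_BS1 lact1.
by rewrite junction_otimes mul1r otimes_thpure ract1.
Qed.

(** [peel_diff] undoes a descent. On b (x) 1 (x) q the two terms come from the Demazure operator at
    q x_s and from x_s times its value at q; by [demazureMeqn] their difference is s(q). *)
Lemma peel_diff_junction t s (u : BS (t ++ [:: s])) :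
  beta (junction_last t s (otimes1 s (ract u (eqnR s)))) -
  act (pr t) (eqnR s) * beta (junction_last t s (otimes1 s u)) = beta u.
Proof.
elim/otimes1_ind: u => [|u v Hu Hv|b q].
- by rewrite ractl0 /otimes1 otimes0l ghom0 !beta0 mulr0 subr0.
- by rewrite ractDl /otimes1 !otimesDl !ghomD !betaD -Hu -Hv mulrDr opprD addrACA.
rewrite [RHS]beta_otimes1_ract ractA !junction_last_otimes1 !beta_otimes1 !beta_ract.
by rewrite -demazureMeqn mulrCA -mulrBr -actM -actB.
Qed.

(** On these inputs the junction yields sums of elements b (x) 1 (x) 1, where m_s does not change
    beta. Thus both children of a descent peel to the same function. *)
Lemma beta_mult_junction t s (u : BS (t ++ [:: s])) :
  beta (mult_last t s (junction_last t s (otimes1 s u))) =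
  beta (junction_last t s (otimes1 s u)).
Proof.
elim/otimes1_ind: u => [|u v Hu Hv|b q].
- by rewrite /otimes1 otimes0l !ghom0 !beta0.
- by rewrite /otimes1 !otimesDl !ghomD !betaD Hu Hv.
by rewrite junction_last_otimes1 mult_last_otimes1 beta_otimes1.
Qed.

(* [f] is the morphism on the first [size e] factors of [e ++ r = E] that
   induces [f']. *)
Definition prefix_mor E e t r (f : ghom (BS e) (BS t)) (f' : ghom (BS E) (BS (t ++ r))) :=
  exists H : e ++ r = E, forall b c, f' (BScast H (otimes b c)) = otimes (f b) c.

Lemma prefix_morS E e t s r f f' : @prefix_mor E e t (s :: r) f f' ->
  exists H : (e ++ [:: s]) ++ r = E, forall b (d : BS [:: s]) (c : BS r),
    f' (BScast H (otimes (otimes b d) c)) = otimes (f b) (otimes d c).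
Proof.
move=> [H Hf].
have H' : (e ++ [:: s]) ++ r = E by rewrite -catA.
exists H' => b d c; rewrite -Hf -(otimes_assoc (catA e [:: s] r)).
by rewrite (BScast_comp _ _ H).
Qed.

Lemma prefix_mor_cat1 E e t s r (f : ghom (BS (e ++ [:: s])) (BS t))
    (f' : ghom (BS E) (BS (t ++ r))) :
  (exists H : (e ++ [:: s]) ++ r = E, forall b (d : BS [:: s]) (c : BS r),
    f' (BScast H (otimes (otimes b d) c)) = otimes (f (otimes b d)) c) ->
  prefix_mor f f'.
Proof.
move=> [H Hf]; exists H => b c; elim/otimes_ind: b => [|b b' Hb Hb'|b d].
- by rewrite otimes0l !ghom0 otimes0l.
- by rewrite otimesDl !ghomD otimesDl Hb Hb'.
- exact: Hf.
Qed.

(** * The four edges of the tree as maps on prefixes *)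

Definition step_up0 e t s (f : ghom (BS e) (BS t)) : ghom (BS (e ++ [:: s])) (BS t) :=
  gcomp (mult_last t s) (rwhisk f [:: s]).
Definition step_up1 e t s (f : ghom (BS e) (BS t)) :
  ghom (BS (e ++ [:: s])) (BS (t ++ [:: s])) := rwhisk f [:: s].
Definition step_down1 e t t' s (B : braid_seq C t (t' ++ [:: s])) (f : ghom (BS e) (BS t)) :
  ghom (BS (e ++ [:: s])) (BS (t' ++ [:: s])) :=
  gcomp (junction_last t' s) (rwhisk (gcomp (braid_seq_mor F B) f) [:: s]).
Definition step_down0 e t t' s (B : braid_seq C t (t' ++ [:: s])) (f : ghom (BS e) (BS t)) :
  ghom (BS (e ++ [:: s])) (BS t') := gcomp (mult_last t' s) (step_down1 B f).

Lemma step_up0_otimes1 e t s (f : ghom (BS e) (BS t)) b : step_up0 s f (otimes1 s b) = f b.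
Proof.
rewrite -[LHS]/(mult_last t s (rwhisk f [:: s] (otimes1 s b))) /otimes1 rwhisk_otimes.
exact: mult_last_otimes1.
Qed.

Lemma step_up1_otimes1 e t s (f : ghom (BS e) (BS t)) b :
  step_up1 s f (otimes1 s b) = otimes1 s (f b).
Proof. exact: rwhisk_otimes. Qed.

Lemma step_down1_otimes e t t' s (B : braid_seq C t (t' ++ [:: s])) (f : ghom (BS e) (BS t))
    b (d : BS [:: s]) :
  step_down1 B f (otimes b d) = junction_last t' s (otimes (braid_seq_mor F B (f b)) d).
Proof.
by congr (junction_last t' s _); rewrite (rwhisk_otimes (gcomp (braid_seq_mor F B) f)).
Qed.

Lemma prefix_up0 E e t s r f f' : @prefix_mor E e t (s :: r) f f' ->
  prefix_mor (step_up0 s f) (gcomp (whisk t (mult rho s) r) f').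
Proof.
move=> /prefix_morS [H Hf]; apply: prefix_mor_cat1; exists H => b d c.
rewrite -[LHS]/(whisk t (mult rho s) r (f' _)) Hf.
rewrite -[step_up0 _ _ _]/(mult_last t s (rwhisk f [:: s] _)) rwhisk_otimes mult_last_otimes.
by rewrite otimes_bal /whisk lwhisk_otimes; congr otimes;
  rewrite (rwhisk_otimes (mult rho s)) otimes_nil.
Qed.

Lemma prefix_up1 E e t s r f f' : @prefix_mor E e t (s :: r) f f' ->
  prefix_mor (step_up1 s f) (gcomp (BScast (catA t [:: s] r)) f').
Proof.
move=> /prefix_morS [H Hf]; apply: prefix_mor_cat1; exists H => b d c.
rewrite -[LHS]/(BScast (catA t [:: s] r) (f' _)) Hf.
by rewrite otimes_assoc -rwhisk_otimes.
Qed.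

(** A descent involves the node and the first letter of its tail; the remaining factor c is carried
    along. *)
Lemma descent_otimes t t' s (B : braid_seq C t (t' ++ [:: s])) r
    (u : BS t) (d : BS [:: s]) (c : BS r) :
  descent_mor F B r (otimes u (otimes d c)) =
  BScast (esym (catA t' [:: s] r))
    (otimes (junction_last t' s (otimes (braid_seq_mor F B u) d)) c).
Proof.
rewrite -[LHS]/(whisk t' (junction rho s) r (BScast _
  (rwhisk (braid_seq_mor F B) (s :: r) (otimes u (otimes d c))))) rwhisk_otimes.
elim/otimes_ind: (braid_seq_mor F B u) => [|v v' Hv Hv'|v d'].
- by rewrite !(otimes0l, ghom0).
- by rewrite !(otimesDl, ghomD) Hv Hv'.
rewrite junction_last_otimes BScast_esym_otimes BScast_esym_otimes /whisk.
have -> : otimes d' (otimes d c) = otimes (otimes d' d) c :> BS ([:: s; s] ++ r).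
  by rewrite -(otimes_assoc (catA [:: s] [:: s] r)) BScast_id.
by rewrite lwhisk_otimes; congr otimes; rewrite (rwhisk_otimes (junction rho s)).
Qed.

Lemma prefix_down1 E e t t' s (B : braid_seq C t (t' ++ [:: s])) r f f' :
  @prefix_mor E e t (s :: r) f f' ->
  prefix_mor (step_down1 B f)
    (gcomp (BScast (catA t' [:: s] r)) (gcomp (descent_mor F B r) f')).
Proof.
move=> /prefix_morS [H Hf]; apply: prefix_mor_cat1; exists H => b d c.
rewrite -[LHS]/(BScast (catA t' [:: s] r) (descent_mor F B r (f' _))) Hf.
by rewrite descent_otimes (BScast_comp _ _ erefl) BScast_id step_down1_otimes.
Qed.

Lemma prefix_down0 E e t t' s (B : braid_seq C t (t' ++ [:: s])) r f f' :
  @prefix_mor E e t (s :: r) f f' ->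
  prefix_mor (step_down0 B f)
    (gcomp (whisk t' (mult rho s) r) (gcomp (descent_mor F B r) f')).
Proof.
move=> /prefix_morS [H Hf]; apply: prefix_mor_cat1; exists H => b d c.
rewrite -[LHS]/(whisk t' (mult rho s) r (descent_mor F B r (f' _))) Hf.
rewrite descent_otimes -[step_down0 _ _ _]/(mult_last t' s (step_down1 B f _)).
rewrite step_down1_otimes.
elim/otimes_ind: (junction_last _ _ _) => [|v v' Hv Hv'|v d'].
- by rewrite !(otimes0l, ghom0).
- by rewrite !(otimesDl, ghomD) Hv Hv'.
rewrite BScast_esym_otimes mult_last_otimes otimes_bal /whisk lwhisk_otimes; congr otimes.
by rewrite (rwhisk_otimes (mult rho s)) otimes_nil.
Qed.

Lemma step_down1_otimes1 e t t' s (B : braid_seq C t (t' ++ [:: s])) (f : ghom (BS e) (BS t)) b :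
  step_down1 B f (otimes1 s b) = junction_last t' s (otimes1 s (braid_seq_mor F B (f b))).
Proof. exact: step_down1_otimes. Qed.

Lemma step_down0_otimes1 e t t' s (B : braid_seq C t (t' ++ [:: s])) (f : ghom (BS e) (BS t)) b :
  step_down0 B f (otimes1 s b) =
  mult_last t' s (junction_last t' s (otimes1 s (braid_seq_mor F B (f b)))).
Proof. by congr (mult_last t' s _); apply: step_down1_otimes1. Qed.

(** The braid moves of a descent depend on the root expression and the path, so a prefix keeps the
    node of the full tree that it comes from. *)
Definition prefix_node E (p : seq bool) e t r (f : ghom (BS e) (BS t)) : Prop :=
  reduced C t /\ exists2 f', @node _ _ _ _ _ rho F ch E p t r f' & prefix_mor f f'.

Lemma prefix_node_root E : @prefix_node E [::] [::] [::] E (gid (BS [::])).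
Proof.
split; first by rewrite /reduced cox_length1.
by exists (gid _); [exact: node_root | exists erefl].
Qed.

Lemma prefix_node_up0 E (p : seq bool) e t s r f : @prefix_node E p e t (s :: r) f ->
  (len (pr t) < len (pr t * g s)%g)%N ->
  @prefix_node E (rcons p false) (e ++ [:: s]) t r (step_up0 s f).
Proof.
move=> [Ht [f' Hf' Hf]] Hl; split=> //.
by exists (gcomp (whisk t (mult rho s) r) f'); [exact: node_up0 | exact: prefix_up0].
Qed.

Lemma prefix_node_up1 E (p : seq bool) e t s r f : @prefix_node E p e t (s :: r) f ->
  (len (pr t) < len (pr t * g s)%g)%N ->
  @prefix_node E (rcons p true) (e ++ [:: s]) (t ++ [:: s]) r (step_up1 s f).
Proof.
move=> [Ht [f' Hf' Hf]] Hl; split; first exact: reduced_rcons.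
by exists (gcomp (BScast (catA t [:: s] r)) f'); [exact: node_up1 | exact: prefix_up1].
Qed.

Section Down.
Variables (E : seq S) (p : seq bool) (e t : seq S) (s : S) (r : seq S).
Variables (f : ghom (BS e) (BS t)).
Hypothesis Hf : @prefix_node E p e t (s :: r) f.
Variables (Ht : reduced C t) (Hs : (len (pr t * g s)%g < len (pr t))%N).
Let m := descent_moves ch E p Ht Hs.

Lemma descent_reduced : reduced C (projT1 m ++ [:: s]).
Proof. exact: braid_seq_reduced (projT2 m) Ht. Qed.

Lemma descent_wprod : pr t = (pr (projT1 m) * g s)%g.
Proof. by rewrite -(braid_seq_wprod (projT2 m)) wprod_cat wprod1. Qed.

Lemma prefix_node_down0 :
  prefix_node E (rcons p false) r (step_down0 (projT2 m) f).
Proof.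
case: Hf => _ [f' Hf' Hff']; split; first exact: (reduced_cat descent_reduced).1.
by eexists; [exact: node_down0 Hf' | exact: prefix_down0].
Qed.

Lemma prefix_node_down1 :
  prefix_node E (rcons p true) r (step_down1 (projT2 m) f).
Proof.
case: Hf => _ [f' Hf' Hff']; split; first exact: descent_reduced.
by eexists; [exact: node_down1 Hf' | exact: prefix_down1].
Qed.
End Down.
End Nodes.

(** * Leaves span with coefficients in an ideal *)

Section Span.
Variables (K : realType) (V : vectType K) (W : groupType) (S : Type).
Variables (C : coxeter_system W S) (rho : reflection_faithful V C).
Variables (F : braid_morphisms rho) (ch : leaf_choices C) (E : seq S).
Local Notation n := (\dim {:V}).
Local Notation R := {mpoly K[n]}.
Local Notation g := (gen C).
Local Notation len := (cox_length C).
Local Notation pr := (wprod g).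
Local Notation BS := (BS rho).
Local Notation beta := (@beta_fun _ _ _ _ _ rho _).
Local Notation prefix_node p e t r f := (@prefix_node _ _ _ _ _ rho F ch E p e t r f).
Implicit Types (s : S) (e t r : seq S) (x y z : W).

Variable I : R -> Prop.
Hypothesis I_add : forall a b, I a -> I b -> I (a + b).
Hypothesis I_mul : forall a b, I b -> I (a * b).

Lemma ideal_subr a b : I a -> I b -> I (a - b).
Proof. by move=> Ha Hb; rewrite -mulN1r; apply/I_add/I_mul. Qed.

(** Combinations, with left coefficients in I, of beta after the nodes with product x. The equations
    are pointwise, so the functions may be exchanged for equal ones. *)
Inductive node_span e r x : (BS e -> R) -> Prop :=
| node_span0 h of (forall b, h b = 0) : node_span r x h
| node_spanD a p t f h h' of I a & prefix_node p e t r f & pr t = x &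
    node_span r x h' & (forall b, h b = a * beta (f b) + h' b) : node_span r x h.

Lemma node_span_eq e r x (h h' : BS e -> R) :
  (forall b, h b = h' b) -> node_span r x h -> node_span r x h'.
Proof.
move=> Eh Hh; case: Hh Eh => [k Hk|a p t f k k' Ha Hf Ht Hk' Hk] Eh.
  by apply: node_span0 => b; rewrite -Eh.
by apply: (node_spanD Ha Hf Ht Hk') => b; rewrite -Eh.
Qed.

Lemma node_span_add e r x (h h' : BS e -> R) :
  node_span r x h -> node_span r x h' -> node_span r x (fun b => h b + h' b).
Proof.
move=> Hh Hh'; elim: {h} Hh => [h Hh|a p t f h k Ha Hf Ht Hk IH Hh].
  by apply: node_span_eq Hh' => b; rewrite Hh add0r.
by apply: (node_spanD Ha Hf Ht IH) => b; rewrite Hh addrA.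
Qed.

Lemma node_span_gen e r p t f a : I a -> prefix_node p e t r f ->
  node_span r (pr t) (fun b => a * beta (f b)).
Proof.
move=> Ha Hf; apply: (node_spanD Ha Hf erefl (h' := fun=> 0)) => [|b].
  exact: node_span0.
by rewrite addr0.
Qed.

Lemma node_span_hom e r x (h : BS e -> R) : node_span r x h -> hom_std x h.
Proof.
elim=> {h} [h Hh|a p t f h k _ _ <- _ IH Hh].
  by rewrite (_ : h = fun=> 0); [exact: bimor0 | exact/funext].
rewrite (_ : h = fun b => a * beta (f b) + k b); last exact/funext.
by apply: hom_std_add IH; apply/hom_std_scale/hom_std_comp/hom_std_beta.
Qed.

Lemma node_span_I e r x (h : BS e -> R) : I 0 -> node_span r x h -> forall b, I (h b).
Proof.
move=> I0; elim=> {h} [h Hh|a p t f h k Ha _ _ _ IH Hh] b; rewrite Hh //.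
by apply: I_add => //; rewrite mulrC; apply: I_mul.
Qed.

(** Each node with product y descends along s. By [peel_diff_junction] both children have beta of
    that node as their [peel_diff]; x decides which child to take. *)
Lemma node_span_down e s r x y (k : BS e -> R) :
  (len (y * g s)%g < len y)%N -> x = (y * g s)%g \/ x = y ->
  node_span (s :: r) y k ->
  exists2 h : BS (e ++ [:: s]) -> R, node_span r x h &
    forall b, peel_diff (y * g s)%g h b = k b.
Proof.
move=> Hs Hx; elim=> {k} [k Hk|a p t f k k' Ha Hf Ey _ [h' Hh' Eh'] Hk].
  exists (fun=> 0) => [|b]; first exact: node_span0.
  by rewrite /peel_diff /peel mulr0 subr0 Hk.
have Ht : reduced C t by case: Hf.
rewrite -Ey in Hs; pose m := descent_moves ch E p Ht Hs.
have Em : pr (projT1 m) = (y * g s)%g by rewrite -Ey (descent_wprod ch E p Ht Hs) mulgenK.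
have [t' [p' [f' [Hf' Et' Ef']]]] : exists t' p' (f' : ghom (BS (e ++ [:: s])) (BS t')),
  [/\ prefix_node p' (e ++ [:: s]) t' r f', pr t' = x &
      forall b, beta (f' (otimes1 s b)) =
        beta (junction_last rho (projT1 m) s (otimes1 s (braid_seq_mor F (projT2 m) (f b))))].
  case: Hx => ->.
    exists (projT1 m), (rcons p false), (step_down0 F (projT2 m) f).
    split=> // [|b]; first exact: prefix_node_down0.
    by rewrite step_down0_otimes1 beta_mult_junction.
  exists (projT1 m ++ [:: s]), (rcons p true), (step_down1 F (projT2 m) f).
  split=> // [||b]; first exact: prefix_node_down1.
    by rewrite wprod_cat wprod1 Em mulgenK.
  by rewrite step_down1_otimes1.
exists (fun b => a * beta (f' b) + h' b) => [|b].
  by rewrite -Et'; apply: node_span_add; [exact: node_span_gen Hf' | rewrite Et'].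
rewrite Hk -Eh' -(beta_braid_seq F (projT2 m) Ht) -peel_diff_junction /peel_diff /peel.
by rewrite !Ef' ghom_ract ghom_ract Em; ring.
Qed.

(** An ascent leaves beta unchanged on b (x) 1 (x) 1; m_s gives the product z and the identity gives
    zs. *)
Lemma node_span_up e s r x z (k : BS e -> R) :
  (len z < len (z * g s)%g)%N -> x = z \/ x = (z * g s)%g ->
  node_span (s :: r) z k ->
  exists2 h : BS (e ++ [:: s]) -> R, node_span r x h & forall b, peel h b = k b.
Proof.
move=> Hs Hx; elim=> {k} [k Hk|a p t f k k' Ha Hf Ez _ [h' Hh' Eh'] Hk].
  by exists (fun=> 0) => [|b]; [exact: node_span0 | rewrite Hk].
rewrite -Ez in Hs.
have [t' [p' [f' [Hf' Et' Ef']]]] : exists t' p' (f' : ghom (BS (e ++ [:: s])) (BS t')),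
  [/\ prefix_node p' (e ++ [:: s]) t' r f', pr t' = x &
      forall b, beta (f' (otimes1 s b)) = beta (f b)].
  case: Hx => ->.
    exists t, (rcons p false), (step_up0 s f).
    by split=> // [|b]; [exact: prefix_node_up0 | rewrite step_up0_otimes1].
  exists (t ++ [:: s]), (rcons p true), (step_up1 s f).
  split=> // [||b]; first exact: prefix_node_up1.
    by rewrite wprod_cat wprod1 Ez.
  by rewrite step_up1_otimes1 beta_otimes1.
exists (fun b => a * beta (f' b) + h' b) => [|b].
  by rewrite -Et'; apply: node_span_add; [exact: node_span_gen Hf' | rewrite Et'].
by rewrite /peel Ef' Hk -Eh'.
Qed.

(** [peel] and [peel_diff] combine values of h with coefficients in R, so they stay in I and the
    induction hypothesis applies to both. The tail r varies because the nodes belong to the tree of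
    the whole E. *)
Lemma node_span_all e r x (h : BS e -> R) : I 0 -> e ++ r = E ->
  hom_std x h -> (forall b, I (h b)) -> node_span r x h.
Proof.
move=> I0; elim/cats1_ind: e r x h => [|e s IH] r x h Er Hh HI.
  have [Ex|Ex] := pselect (x = 1%g); last first.
    exact/node_span0/(hom_std_nil_neq1 Hh).
  have Hr : prefix_node [::] [::] [::] r (gid (BS [::])).
    by rewrite -[r]/([::] ++ r) Er; apply: prefix_node_root.
  rewrite Ex; apply: node_span_eq (node_span_gen (HI (1 : R)) Hr) => b.
  by rewrite mulrC -(hom_std_nil b Hh).
have Es : e ++ s :: r = E by rewrite -Er -catA.
(* The shorter of x and xs. *)
have [z [Hz Hx]] : exists z, (len z < len (z * g s)%g)%N /\ (x = z \/ x = (z * g s)%g).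
  have [H|H] := cox_length_cases C x s; first by exists x; split=> //; left.
  by exists (x * g s)%g; rewrite mulgenK; split=> //; right.
have Hd := hom_std_peel_diff Hh Hx.
have Hd1 : node_span (s :: r) (z * g s)%g (peel_diff z h).
  apply: IH Es Hd _ => b; rewrite /peel_diff /peel.
  by apply: ideal_subr => //; apply: I_mul.
(* Descent with y = zs, so that ys = z: h1 has the same [peel_diff] as h. *)
have [||h1 Hh1 Eh1] := node_span_down (x := x) _ _ Hd1; try by rewrite mulgenK.
rewrite mulgenK in Eh1.
have Hh1' := node_span_hom Hh1.
have Hk : hom_std x (fun b => h b - h1 b).
  by apply: hom_std_add Hh _; apply: bimorN.
(* The two differences cancel, which makes the peel of h - h1 right linear for z. *)
have H2 : hom_std z (peel (fun b => h b - h1 b)).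
  apply: (hom_std_peel Hk Hx) => b; rewrite /peel_diff /peel.
  have := Eh1 b; rewrite /peel_diff /peel => /(canRL (subrK _)) ->; ring.
have H3 : node_span (s :: r) z (peel (fun b => h b - h1 b)).
  by apply: IH Es H2 _ => b; apply: ideal_subr => //; apply: (node_span_I I0 Hh1).
have [h2 Hh2 Eh2] := node_span_up Hz Hx H3.
(* h2 and h - h1 agree on the generators b (x) 1 (x) 1, hence everywhere. *)
apply: node_span_eq (node_span_add Hh1 Hh2) => b.
have := hom_std_eq1 (node_span_hom Hh2) Hk Eh2 b.
by move=> ->; rewrite addrC subrK.
Qed.
End Span.

(** * Leaves and the residue *)

Section Leaves.
Variables (K : realType) (V : vectType K) (W : groupType) (S : Type).
Variables (C : coxeter_system W S) (rho : reflection_faithful V C).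
Variables (F : braid_morphisms rho) (ch : leaf_choices C).
Local Notation n := (\dim {:V}).
Local Notation R := {mpoly K[n]}.
Local Notation g := (gen C).
Local Notation len := (cox_length C).
Local Notation pr := (wprod g).
Local Notation act := (act rho).
Local Notation eqnR := (eqnR rho).
Local Notation BS := (BS rho).
Local Notation BS1 := (BS1 rho).
Local Notation BScast := (BScast rho).
Local Notation beta := (@beta_fun _ _ _ _ _ rho _).
Implicit Types (s : S) (e t r : seq S) (x y z : W).

Lemma braid_seq_mor_BS1 e e' (B : braid_seq C e e') :
  braid_seq_mor F B (BS1 e) = BS1 e'.
Proof.
elim: B => // a s t c e1 Hst Hm B IH.
rewrite -[LHS]/(braid_seq_mor F B (whisk a (braid_mor F s t) c (BS1 _))).
by rewrite /whisk -!BS1_cat lwhisk_otimes rwhisk_otimes braid_mor1 // !BS1_cat.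
Qed.

Lemma BScast_deg e e' (H : e = e') i (b : BS e) : bdeg i b -> bdeg i (BScast H b).
Proof. by case: _ / H. Qed.

Lemma mcoeff0_beta_ract e (b : BS e) q :
  (beta (ract b q))@_0%MM = (beta b)@_0%MM * q@_0%MM.
Proof. by rewrite beta_ract mcoeff0M mcoeff0_act. Qed.

Lemma mcoeff0_beta_otimes e e' (b : BS e) (c : BS e') :
  (beta (otimes b c))@_0%MM = (beta b)@_0%MM * (beta c)@_0%MM.
Proof. by rewrite beta_otimes mcoeff0M mcoeff0_act. Qed.

(* [d] counts the junctions in [f] and [b] has x_s inserted before each of them,
   where demazure s x_s = 1. *)
Definition up_to_junctions e t (f : ghom (BS e) (BS t)) : Prop :=
  exists (d : nat) (b : BS e), [/\ bdeg (- (size e)%:Z + d.*2%:Z) b, f b = BS1 t &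
    d = 0%N -> forall c, (beta (f c))@_0%MM = (beta c)@_0%MM].

Lemma utj_gid : up_to_junctions (gid (BS [::])).
Proof. by exists 0%N, (1 : R); split=> //; apply: rdeg1. Qed.

Lemma otimes1_deg e s (b : BS e) i : bdeg (- (size e)%:Z + i) b ->
  bdeg (- (size (e ++ [:: s]))%:Z + i) (otimes1 s b).
Proof.
move=> Hb; rewrite size_cat PoszD opprD addrAC.
exact: otimes_deg Hb (BS1_deg1 rho s).
Qed.

Lemma mcoeff0_beta_otimes1 e t' t s (f : ghom (BS e) (BS t))
    (f' : ghom (BS (e ++ [:: s])) (BS t')) :
  (forall c, beta (f' (otimes1 s c)) = beta (f c)) ->
  (forall c, (beta (f c))@_0%MM = (beta c)@_0%MM) ->
  forall c, (beta (f' c))@_0%MM = (beta c)@_0%MM.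
Proof.
move=> Hf' Hf; elim/otimes1_ind => [|u v Hu Hv|b q]; first by rewrite ghom0 !beta0.
  by rewrite ghomD !betaD !mcoeffD Hu Hv.
by rewrite ghom_ract !mcoeff0_beta_ract Hf' Hf beta_otimes1.
Qed.

Lemma utj_up0 e t s (f : ghom (BS e) (BS t)) :
  up_to_junctions f -> up_to_junctions (step_up0 s f).
Proof.
move=> [d [b [Hb Hfb Hd]]]; exists d, (otimes1 s b); split=> [||/Hd Hf].
- exact: otimes1_deg.
- by rewrite step_up0_otimes1.
- by apply: mcoeff0_beta_otimes1 Hf => c; rewrite step_up0_otimes1.
Qed.

Lemma utj_up1 e t s (f : ghom (BS e) (BS t)) :
  up_to_junctions f -> up_to_junctions (step_up1 s f).
Proof.
move=> [d [b [Hb Hfb Hd]]]; exists d, (otimes1 s b); split=> [||/Hd Hf].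
- exact: otimes1_deg.
- by rewrite step_up1_otimes1 Hfb; apply: BS1_cat.
- by apply: mcoeff0_beta_otimes1 Hf => c; rewrite step_up1_otimes1 beta_otimes1.
Qed.

Lemma utj_down1 e t t' s (B : braid_seq C t (t' ++ [:: s])) (f : ghom (BS e) (BS t)) :
  up_to_junctions f -> up_to_junctions (step_down1 F B f).
Proof.
(* The inserted x_s adds 2 to the degree. The new count is positive, so the clause on constant terms
   holds vacuously. *)
move=> [d [b [Hb Hfb _]]]; exists d.+1, (otimes1 s (ract b (eqnR s))); split=> //.
  apply: otimes1_deg; rewrite doubleS -addn2 PoszD addrA.
  by apply: bdeg_ract Hb _; apply: rdeg_linform.
rewrite step_down1_otimes1 !ghom_ract Hfb braid_seq_mor_BS1 -BS1_cat.
rewrite -[otimes _ _]/(otimes1 s (BS1 t')) junction_last_otimes1 demazure_eqnR ract1.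
by [].
Qed.

Lemma utj_down0 e t t' s (B : braid_seq C t (t' ++ [:: s])) (f : ghom (BS e) (BS t)) :
  up_to_junctions f -> up_to_junctions (step_down0 F B f).
Proof.
move=> [d [b [Hb Hfb _]]]; exists d.+1, (otimes1 s (ract b (eqnR s))); split=> //.
  apply: otimes1_deg; rewrite doubleS -addn2 PoszD addrA.
  by apply: bdeg_ract Hb _; apply: rdeg_linform.
rewrite step_down0_otimes1 !ghom_ract Hfb braid_seq_mor_BS1 -BS1_cat.
rewrite -[otimes _ _]/(otimes1 s (BS1 t')) junction_last_otimes1 demazure_eqnR ract1.
exact: mult_last_otimes1.
Qed.

(** Each edge of the tree is induced by the corresponding step on the letters read so far, so
    [up_to_junctions] can be followed along the path. *)
Lemma node_prefix E p t r f' : @node _ _ _ _ _ rho F ch E p t r f' ->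
  exists e (f : ghom (BS e) (BS t)), prefix_mor f f' /\ up_to_junctions f.
Proof.
elim=> {p t r f'} [|p t s r f' _ [e [f [Hf Hu]]] _|p t s r f' _ [e [f [Hf Hu]]] _
  |p t s r f' Ht Hs _ [e [f [Hf Hu]]] m|p t s r f' Ht Hs _ [e [f [Hf Hu]]] m].
- by exists [::], (gid _); split; [exists erefl | exact: utj_gid].
- by exists (e ++ [:: s]), (step_up0 s f); split; [exact: prefix_up0 | exact: utj_up0].
- by exists (e ++ [:: s]), (step_up1 s f); split; [exact: prefix_up1 | exact: utj_up1].
- exists (e ++ [:: s]), (step_down0 F (projT2 m) f).
  by split; [exact: prefix_down0 | exact: utj_down0].
- exists (e ++ [:: s]), (step_down1 F (projT2 m) f).
  by split; [exact: prefix_down1 | exact: utj_down1].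
Qed.

(** The leaf sends an element of degree 2d - [size e] to 1 (x) ... (x) 1, of degree -l(u). Its
    degree [size e] - l(u) leaves only d = 0: no junction occurs, and the other steps preserve
    constant terms. *)
Lemma leaf_mcoeff0_beta e u (l : ghom (BS e) (BS (rex ch u))) :
  leaf F ch e u l -> homdeg ((size e)%:Z - (len u)%:Z) l ->
  forall b, (beta (l b))@_0%MM = (beta b)@_0%MM.
Proof.
case=> p t f' Ht /node_prefix [e' [f [[H Hf] [d [b0 [Hb0 Hfb0 Hd]]]]]] [_ Hl].
set B := braid_seq_mor F _ in Hl *.
have Elen : len (pr t) = size (rex ch (pr t)).
  by have /eqP := rex_reduced ch (pr t); rewrite rex_prod.
have Esize : size e' = size e by rewrite -H cats0.
have d0 : d = 0%N.
  have /BScast_deg -/(_ _ H) /Hl := otimes_deg Hb0 (rdeg1 V : bdeg 0 (1 : BS [::])).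
  rewrite /= Hf otimes_nilr ract1 Hfb0 braid_seq_mor_BS1 => /BS1_deg_uniq.
  rewrite addr0 Elen Esize addrACA addrC addrA subrK => /(canRL (subrK _)).
  by rewrite addNr => -[] /eqP; rewrite double_eq0 => /eqP.
move=> b; rewrite -[LHS]/((beta (B (BScast (cats0 t) (f' b))))@_0%MM).
rewrite beta_braid_seq // beta_cast.
have -> : b = BScast H (BScast (esym H) b) by rewrite (BScast_comp _ _ erefl).
elim/otimes_ind: (BScast _ b) => [|c c' Hc Hc'|c q]; first by rewrite !ghom0 !beta0.
  by rewrite !ghomD !betaD !mcoeffD Hc Hc'.
by rewrite Hf beta_cast !mcoeff0_beta_otimes Hd.
Qed.

Lemma beta_atE x (b : BS (rex ch x)) : beta_at rho ch x b = beta b :> R.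
Proof.
suff H y (Ey : pr (rex ch x) = y) : (match Ey in _ = z
    return ghom (BS (rex ch x)) (standard rho z) with
  | erefl => Defs.beta rho (rex ch x) end : BS _ -> R) b = beta_fun b by exact: H.
by case: _ / Ey.
Qed.

(** * Reduction modulo R^+ and the pairing with BS(e) *)

Section Residue.
Variables (e : seq S) (x : W).
Implicit Types (f : ghom (BS e) (standard rho x)).

Lemma hom_classD f f' : hom_class e x (f + f') = hom_class e x f + hom_class e x f'.
Proof. exact: (@tpureDl _ _ _ (hombimod _ _)). Qed.

Lemma hom_class_ract f (a : R) :
  hom_class e x (hract f a) = ract (hom_class e x f) (a@_0%MM)%:MP.
Proof.
rewrite /hom_class [RHS]tract_pure.
rewrite [LHS](@tpure_bal _ _ _ (hombimod _ _) (residue K n)) //.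
by congr tpure; rewrite /= mulr1 mul1r mcoeffC eqxx mulr1.
Qed.

Lemma hom_class_surj (z : hom_residue rho e x) : exists f, z = hom_class e x f.
Proof.
elim/tensor_ind: z => [|z z' [f ->] [f' ->]|f c].
- by exists 0; rewrite /hom_class tpure0l.
- by exists (f + f'); rewrite hom_classD.
- exists (hract f c%:MP); rewrite /hom_class.
  rewrite [RHS](@tpure_bal _ _ _ (hombimod _ _) (residue K n)) //.
  by congr tpure; rewrite /= mulr1 mcoeffC eqxx mulr1.
Qed.

(** The class of f is paired with b by the constant term of f(b); this is balanced because acting on
    the right by a multiplies constant terms by that of a. *)
Definition aug (b : BS e) (z : hom_residue rho e x) : K :=
  tlift (fun (f : hombimod (BS e) (standard rho x)) (c : residue K n) =>
    ((gfun f b : R)@_0%MM * (c : K) : K)) z.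

Lemma balanced_aug b : balanced (fun _ => True)
  (fun (f : hombimod (BS e) (standard rho x)) (c : residue K n) =>
    ((gfun f b : R)@_0%MM * (c : K) : K)).
Proof.
split=> [f f' c|f c c'|f a c _] /=.
- by rewrite mcoeffD mulrDl.
- by rewrite mulrDr.
- by rewrite mcoeff0M mcoeff0_act mulrA.
Qed.

Lemma aug_class b f : aug b (hom_class e x f) = (f b : R)@_0%MM.
Proof. by rewrite /aug tliftE ?mulr1 //; apply: balanced_aug. Qed.

Lemma augD b (z z' : hom_residue rho e x) : aug b (z + z') = aug b z + aug b z'.
Proof. exact/tliftD/balanced_aug. Qed.

Lemma aug0 b : aug b 0 = 0.
Proof. exact/tlift0/balanced_aug. Qed.

Lemma aug_ract b (z : hom_residue rho e x) c : aug b (ract z c%:MP) = aug b z * c.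
Proof.
have [f ->] := hom_class_surj z; have -> : c = (c%:MP_[n])@_0%MM.
  by rewrite mcoeffC eqxx mulr1.
by rewrite -hom_class_ract !aug_class [X in X@_0%MM]/= mcoeff0M mcoeff0_act.
Qed.
End Residue.

(** With an empty tail only the final braid moves remain, and these preserve beta. *)
Lemma prefix_node_leaf e p t (f : ghom (BS e) (BS t)) v :
  @prefix_node _ _ _ _ _ rho F ch e p e t [::] f -> pr t = v ->
  exists2 l, leaf F ch e v l & forall b, beta (l b) = beta (f b).
Proof.
move=> [Ht [f' Hf' [H Hf]]] <-.
eexists; first exact: (Leaf Ht Hf') => b.
move=> b; rewrite -[LHS]/(beta (braid_seq_mor F _ (BScast (cats0 t) (f' b)))).
rewrite beta_braid_seq // beta_cast.
have -> : b = BScast H (@otimes _ _ _ _ _ rho e [::] b (1 : R)).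
  by rewrite otimes_nilr ract1.
by rewrite Hf beta_otimes otimes_nilr ract1 [beta_fun _ in X in _ * X]/= act1 mulr1.
Qed.

(** The span has left coefficients, the residue is taken on the right. On R_v, left multiplication
    by a is the right action of v^-1(a), which has the same constant term. *)
Lemma hom_class_leaf e p t (f : ghom (BS e) (BS t)) v a
    (h : ghom (BS e) (standard rho v)) (h' : BS e -> R) :
  @prefix_node _ _ _ _ _ rho F ch e p e t [::] f -> pr t = v ->
  (forall b, h b = a * beta (f b) + h' b) ->
  exists l (h1 : ghom (BS e) (standard rho v)), [/\ leaf F ch e v l,
    forall b, beta (l b) = beta (f b),
    forall b, h1 b = h' b &
    hom_class e v h =
      ract (hom_class e v (gcomp (beta_at rho ch v) l)) (a@_0%MM)%:MP + hom_class e v h1].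
Proof.
move=> Hf Et Hh; have [l Hl El] := prefix_node_leaf Hf Et.
pose k := hract (gcomp (beta_at rho ch v) l) (act v^-1%g a).
exists l, (h - k); split=> // [b|].
  rewrite -[LHS]/(h b - beta_at rho ch v (l b) * act v (act v^-1%g a)).
  by rewrite Hh beta_atE El act_act mulgV act_1 mulrC addrC addKr.
by rewrite -(mcoeff0_act rho v^-1%g) -hom_class_ract -hom_classD addrC subrK.
Qed.
End Leaves.

Theorem proposition5p6 (K : realType) (V : vectType K) (W : groupType) (S : Type)
    (C : coxeter_system W S) (rho : reflection_faithful V C)
    (F : braid_morphisms rho) (ch : leaf_choices C) (u v w : W) :
  bruhat C u v -> bruhat C v w ->
  identity_leaf F ch u -> identity_leaf F ch v -> identity_leaf F ch w ->
  forall G : ghom (BS rho (rex ch v)) (BS rho (rex ch u)),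
    leaf F ch (rex ch v) u G ->
    homdeg ((cox_length C v)%:Z - (cox_length C u)%:Z) G ->
  forall Phi : hom_residue rho (rex ch w) v -> hom_residue rho (rex ch w) u,
    scalar_linear Phi ->
    (forall l : ghom (BS rho (rex ch w)) (BS rho (rex ch v)), leaf F ch (rex ch w) v l ->
      Phi (hom_class (rex ch w) v (gcomp (beta_at rho ch v) l)) =
      hom_class (rex ch w) u (gcomp (beta_at rho ch u) (gcomp G l))) ->
  injective Phi.
Proof.
move=> _ _ _ _ _ G HG degG Phi [PhiD PhiZ] HPhi.
have Ev : size (rex ch v) = cox_length C v.
  by have /eqP -> := rex_reduced ch v; rewrite rex_prod.
rewrite -Ev in degG; have Gaug := leaf_mcoeff0_beta HG degG.
have Phi0 : Phi 0 = 0 by apply: (@addrI _ (Phi 0)); rewrite -PhiD !addr0.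
(* Spanning, with I = R, reduces this to leaves l, where composition with G preserves the constant
   term of beta. *)
have aug_Phi (h : ghom (BS rho (rex ch w)) (standard rho v)) b :
    aug b (Phi (hom_class (rex ch w) v h)) = (h b)@_0%MM.
  have : node_span F ch (rex ch w) (fun _ => True) [::] v h.
    by apply: node_span_all; rewrite ?cats0 //; apply: ghom_bimor.
  suff span_aug k : node_span F ch (rex ch w) (fun _ => True) [::] v k ->
      forall h : ghom (BS rho (rex ch w)) (standard rho v), (forall c, h c = k c) ->
      aug b (Phi (hom_class (rex ch w) v h)) = (k b)@_0%MM by move/span_aug; apply.
  elim=> {h} [{}k Hk|a p t f {}k k' _ Hf Et _ IH Hk] h Ek.
    have -> : h = 0 by apply: ghom_eq => c; rewrite Ek Hk.
    by rewrite /hom_class tpure0l Phi0 aug0 Hk mcoeff0.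
  have [|l [h1 [Hl El Eh1 ->]]] := hom_class_leaf (h := h) (a := a) (h' := k') Hf Et.
    by move=> c; rewrite Ek Hk.
  rewrite PhiD PhiZ HPhi // augD aug_ract aug_class (IH _ Eh1).
  rewrite -[gcomp _ _ b]/(beta_at rho ch u (G (l b))) beta_atE Gaug El.
  by rewrite Hk mcoeffD mcoeff0M mulrC.
(* By [aug_Phi] a class in the kernel has a representative with values in R^+, so the span applies
   with I = R^+. *)
have Phi_ker z : Phi z = 0 -> z = 0.
  have [h ->] := hom_class_surj z => Hz.
  have : node_span F ch (rex ch w) (fun a => a@_0%MM = 0) [::] v h.
    apply: node_span_all => [a b Ha Hb|a b Hb||||b].
    - by rewrite mcoeffD Ha Hb addr0.
    - by rewrite mcoeff0M Hb mulr0.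
    - exact: mcoeff0.
    - exact: cats0.
    - exact: ghom_bimor.
    - by rewrite -aug_Phi Hz aug0.
  suff span0 k : node_span F ch (rex ch w) (fun a => a@_0%MM = 0) [::] v k ->
      forall h : ghom (BS rho (rex ch w)) (standard rho v), (forall c, h c = k c) ->
      hom_class (rex ch w) v h = 0 by move/span0; apply.
  elim=> {h Hz} [{}k Hk|a p t f {}k k' Ha Hf Et _ IH Hk] h Ek.
    have -> : h = 0 by apply: ghom_eq => c; rewrite Ek Hk.
    exact: tpure0l.
  have [|l [h1 [Hl El Eh1 ->]]] := hom_class_leaf (h := h) (a := a) (h' := k') Hf Et.
    by move=> c; rewrite Ek Hk.
  (* The coefficient a lies in R^+, so its term vanishes in the residue. *)
  by rewrite Ha mpolyC0 ractr0 add0r IH.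
move=> z z' E; apply/eqP; rewrite -subr_eq0; apply/eqP/Phi_ker.
by apply: (addIr (Phi z')); rewrite -PhiD subrK add0r.
Qed.
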